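(* Let $\mathbb{F}$ be a field and let $C_n^2$ be the graph on $\{1,\ldots,n\}$ with edges $\{i,i+1\}$ and $\{i,i+2\}$ for $i=1,\ldots,n$, where indices are taken modulo $n$. If $n>6$, then $\mathbb{F}[\Delta_2^t(C^2_n)]$ does not have a linear resolution and is not Cohen-Macaulay. If $n=6$, then $\mathbb{F}[\Delta_2^t(C^2_6)]$ has a linear resolution with Betti numbers $$\beta_{0,0}=\beta_{4,6}=1,\qquad \beta_{1,3}=8,\qquad \beta_{2,4}=12,\qquad \beta_{3,5}=6,$$ but is not Cohen-Macaulay.
   Context: A simplicial complex on a finite set $V$ is a collection of subsets of $V$ closed under taking subsets (an element of $V$ need not itself be a face). Its Stanley-Reisner ring over $\mathbb{F}$ is $\mathbb{F}[\Delta]=S/I_\Delta$, where $S=\mathbb{F}[x_v : v\in V]$ and $I_\Delta$ is generated by the monomials $\prod_{v\in F}x_v$ for all $F\subseteq V$ with $F\notin\Delta$. For a finite simple graph $G=(V,E)$ and a positive integer $k$, $\Delta_k^t(G)$ is the simplicial complex on $V$ whose facets are the complements $V\setminus M$ of the independent sets $M\subseteq V$ of size $k$ (independent: no two elements adjacent). For a homogeneous ideal $I\subseteq S$, $\beta_{i,j}=\dim_{\mathbb{F}}\mathrm{Tor}^S_i(S/I,\mathbb{F})_j$ are the graded Betti numbers of $S/I$; when Betti numbers of a ring are listed, all Betti numbers not listed are zero. $S/I$ has an $s$-linear resolution if $I$ is generated in degree $s$ and $\beta_{i,j}=0$ whenever $i\ge1$ and $j\ne s+i-1$; it has a linear resolution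 if it has an $s$-linear resolution for some $s\ge 1$. *)

(* Defs.v *)
From HB Require Import structures.
From mathcomp Require Import all_boot all_order all_algebra.
From mathcomp Require Import boolp classical_sets.
From mathcomp Require Import mpoly.

Set Implicit Arguments.
Unset Strict Implicit.
Unset Printing Implicit Defensive.

Import GRing.Theory.

Local Open Scope ring_scope.
Local Open Scope quotient_scope.
Local Open Scope classical_set_scope.

(* Commutative rings are comPzRingType's, so that the zero ring is allowed as a
   quotient. *)
Record ideal (R : comPzRingType) := Ideal {
  ideal_set :> set R;
  ideal_has0 : ideal_set 0;
  ideal_add : forall x y, ideal_set x -> ideal_set y -> ideal_set (x + y);
  ideal_mul : forall a x, ideal_set x -> ideal_set (a * x)
}.

Definition ideal_mem (R : comPzRingType) (I : ideal R) (x : R) : Prop :=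
  ideal_set I x.
Coercion ideal_mem : ideal >-> Funclass.

Section GeneratedIdeal.
Variables (R : comPzRingType) (G : set R).

Definition gen_set : set R := fun x => forall J : ideal R, G `<=` J -> J x.

Fact gen_set0 : gen_set 0.
Proof. by move=> J _; exact: ideal_has0. Qed.

Fact gen_setD x y : gen_set x -> gen_set y -> gen_set (x + y).
Proof. by move=> Gx Gy J GJ; apply: ideal_add; [exact: Gx|exact: Gy]. Qed.

Fact gen_setM a x : gen_set x -> gen_set (a * x).
Proof. by move=> Gx J GJ; apply: ideal_mul; exact: Gx. Qed.

Definition ideal_gen : ideal R := Ideal gen_set0 gen_setD gen_setM.

End GeneratedIdeal.

(* mathcomp's {ideal_quot I} covers proper ideals only; the ring structure below
   is put on the same underlying quotient, for an arbitrary ideal. *)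
Section QuotientRing.
Variables (R : comPzRingType) (I : ideal R).

Definition ideal_pred : {pred R} := fun x => `[< I x >].

Fact ideal_pred_zmod_closed : zmod_closed ideal_pred.
Proof.
split=> [|x y /asboolP Ix /asboolP Iy]; apply/asboolP; first exact: ideal_has0.
by rewrite -mulN1r; apply: ideal_add => //; apply: ideal_mul.
Qed.

HB.instance Definition _ :=
  GRing.isZmodClosed.Build R ideal_pred ideal_pred_zmod_closed.

Definition quotient_ring : Type := Quotient.quot ideal_pred.

HB.instance Definition _ := GRing.Zmodule.on quotient_ring.

Definition quotient_proj (x : R) : quotient_ring :=
  \pi_(Quotient.quot ideal_pred) x.

Definition quotient_one : quotient_ring := quotient_proj 1.
Definition quotient_mul (x y : quotient_ring) : quotient_ring :=
  quotient_proj (repr (x : Quotient.quot ideal_pred) *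
                 repr (y : Quotient.quot ideal_pred)).

Fact quotient_proj_eq (x y : R) :
  quotient_proj x = quotient_proj y <-> I (x - y).
Proof.
split=> [/eqP | Ixy]; last apply/eqP; rewrite /quotient_proj -Quotient.idealrBE.
  by move/asboolP.
exact/asboolP.
Qed.

Fact quotient_projK (x : quotient_ring) :
  quotient_proj (repr (x : Quotient.quot ideal_pred)) = x.
Proof. exact: reprK. Qed.

Fact quotient_proj_ind (P : quotient_ring -> Prop) :
  (forall x, P (quotient_proj x)) -> forall x, P x.
Proof. by move=> Pp x; rewrite -(quotient_projK x). Qed.

Fact quotient_projM (x y : R) :
  quotient_proj (x * y) = quotient_mul (quotient_proj x) (quotient_proj y).
Proof.
apply/quotient_proj_eq.
set x' := repr _; set y' := repr _.
have Ix : I (x - x') by apply/quotient_proj_eq; rewrite quotient_projK.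
have Iy : I (y - y') by apply/quotient_proj_eq; rewrite quotient_projK.
have -> : x * y - x' * y' = y * (x - x') + x' * (y - y').
  by rewrite !mulrBr addrA (mulrC y x') subrK mulrC.
by apply: ideal_add; apply: ideal_mul.
Qed.

Fact quotient_projD (x y : R) :
  quotient_proj (x + y) = quotient_proj x + quotient_proj y.
Proof. exact: (raddfD \pi_(Quotient.quot ideal_pred)). Qed.

Fact quotient_mulA : associative quotient_mul.
Proof.
elim/quotient_proj_ind=> x; elim/quotient_proj_ind=> y.
by elim/quotient_proj_ind=> z; rewrite -!quotient_projM mulrA.
Qed.

Fact quotient_mulC : commutative quotient_mul.
Proof.
elim/quotient_proj_ind=> x; elim/quotient_proj_ind=> y.
by rewrite -!quotient_projM mulrC.
Qed.

Fact quotient_mul1 : left_id quotient_one quotient_mul.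
Proof. by elim/quotient_proj_ind=> x; rewrite -quotient_projM mul1r. Qed.

Fact quotient_mulD : left_distributive quotient_mul +%R.
Proof.
elim/quotient_proj_ind=> x; elim/quotient_proj_ind=> y.
elim/quotient_proj_ind=> z.
by rewrite -quotient_projD -!quotient_projM mulrDl quotient_projD.
Qed.

Fact quotient_mul0 : left_zero 0 quotient_mul.
Proof.
have proj0 : quotient_proj 0 = 0 := raddf0 \pi_(Quotient.quot ideal_pred).
by elim/quotient_proj_ind=> x; rewrite -proj0 -quotient_projM mul0r.
Qed.

Fact quotient_mulDr : right_distributive quotient_mul +%R.
Proof. by move=> x y z; rewrite !(quotient_mulC x) quotient_mulD. Qed.

Fact quotient_mul1r : right_id quotient_one quotient_mul.
Proof. by move=> x; rewrite quotient_mulC quotient_mul1. Qed.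

HB.instance Definition _ := GRing.Zmodule_isPzRing.Build quotient_ring
  quotient_mulA quotient_mul1 quotient_mul1r quotient_mulD quotient_mulDr.
HB.instance Definition _ :=
  GRing.PzRing_hasCommutativeMul.Build quotient_ring quotient_mulC.

Fact quotient_proj_zmod : zmod_morphism quotient_proj.
Proof. exact: (raddfB \pi_(Quotient.quot ideal_pred)). Qed.

Fact quotient_proj_monoid : monoid_morphism quotient_proj.
Proof. by split=> // x y; exact: quotient_projM. Qed.

HB.instance Definition _ :=
  GRing.isZmodMorphism.Build R quotient_ring quotient_proj quotient_proj_zmod.
HB.instance Definition _ :=
  GRing.isMonoidMorphism.Build R quotient_ring quotient_proj
    quotient_proj_monoid.

End QuotientRing.

Section CohenMacaulay.
Implicit Types A B : comPzRingType.

Definition prime_ideal A (P : ideal A) : Prop :=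
  ~ P 1 /\ forall x y, P (x * y) -> P x \/ P y.

Definition maximal_ideal A (M : ideal A) : Prop :=
  ~ M 1 /\ forall J : ideal A, M `<=` J -> ~ J 1 -> J `<=` M.

Definition prime_chain A (d : nat) (P : nat -> ideal A) : Prop :=
  (forall i, (i <= d)%N -> prime_ideal (P i)) /\
  (forall i, (i < d)%N -> (P i : set A) `<` P i.+1).

Definition krull_dim A (d : nat) : Prop :=
  (exists P : nat -> ideal A, prime_chain d P) /\
  (forall e (P : nat -> ideal A), prime_chain e P -> (e <= d)%N).

Definition regular_sequence A (s : seq A) : Prop :=
  ~ ideal_gen [set` s] 1 /\
  forall i, (i < size s)%N -> forall y : A,
    ideal_gen [set` take i s] (s`_i * y) -> ideal_gen [set` take i s] y.

Definition local_ring A (M : ideal A) : Prop :=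
  maximal_ideal M /\
  forall M' : ideal A, maximal_ideal M' -> (M' : set A) = M.

Definition depth A (M : ideal A) (d : nat) : Prop :=
  (exists s : seq A, [/\ size s = d, [set` s] `<=` M & regular_sequence s]) /\
  (forall s : seq A, [set` s] `<=` M -> regular_sequence s -> (size s <= d)%N).

Definition cohen_macaulay_local A : Prop :=
  exists M : ideal A, local_ring M /\ exists d, krull_dim A d /\ depth M d.

(* f exhibits B as the localization of A at P; this determines (B, f) up to a
   unique isomorphism under A. *)
Definition is_localization A (P : ideal A) B (f : {rmorphism A -> B}) : Prop :=
  [/\ forall s, ~ P s -> exists t, f s * t = 1,
      forall b, exists a s, ~ P s /\ b * f s = f a &
      forall a, f a = 0 -> exists s, ~ P s /\ s * a = 0].

(* Meant for noetherian rings only. *)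
Definition cohen_macaulay A : Prop :=
  forall M : ideal A, maximal_ideal M ->
    exists (B : comPzRingType) (f : {rmorphism A -> B}),
      is_localization M f /\ cohen_macaulay_local B.

End CohenMacaulay.

Section GradedBettiNumbers.
Variables (F : fieldType) (n : nat).
Local Notation S := {mpoly F[n]}.

(* ... -> F_1 -> F_0 with F_i free of finite rank over S, on generators of the
   prescribed degrees.  Elements of F_i are row vectors, and
   F_(i+1) -> F_i is right multiplication by gfc_diff i. *)
Record graded_free_complex := GradedFreeComplex {
  gfc_rank : nat -> nat;
  gfc_deg : forall i, 'I_(gfc_rank i) -> int;
  gfc_diff : forall i, 'M[S]_(gfc_rank i.+1, gfc_rank i);
  gfc_homog : forall i a b m, m \in msupp (gfc_diff i a b) ->
    (mdeg m)%:Z + gfc_deg b = gfc_deg a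
}.

(* The augmentation F_0 -> S/I is v |-> class of (v *m eps) 0 0. *)
Definition resolves (C : graded_free_complex) (I : ideal S) : Prop :=
  exists eps : 'cV[S]_(gfc_rank C 0),
    [/\ forall a m, m \in msupp (eps a 0) -> (mdeg m)%:Z = gfc_deg a,
        forall q : quotient_ring I, exists v : 'rV_(gfc_rank C 0),
          q = quotient_proj I ((v *m eps) 0 0),
        forall v : 'rV_(gfc_rank C 0),
          quotient_proj I ((v *m eps) 0 0) = 0 <->
          exists w, v = w *m gfc_diff C 0 &
        forall i (v : 'rV_(gfc_rank C i.+1)),
          v *m gfc_diff C i = 0 <-> exists w, v = w *m gfc_diff C i.+1].

Section Tor.
Variable C : graded_free_complex.

(* C tensored with F = S/(x_1, ..., x_n): only constant terms survive. *)
Definition tensor_diff (i : nat) : 'M[F]_(gfc_rank C i.+1, gfc_rank C i) :=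
  map_mx (mcoeff 0%MM) (gfc_diff C i).

(* Row space: the degree j part of F_i tensored with F. *)
Definition tensor_deg (i : nat) (j : int) : 'M[F]_(gfc_rank C i) :=
  diag_mx (\row_a (gfc_deg a == j)%:R).

Definition tensor_cycles (i : nat) (j : int) : 'M[F]_(gfc_rank C i) :=
  match i with
  | 0 => tensor_deg 0 j
  | i'.+1 => (tensor_deg i'.+1 j :&: kermx (tensor_diff i'))%MS
  end.

Definition tensor_boundaries (i : nat) (j : int) :
    'M[F]_(gfc_rank C i.+1, gfc_rank C i) :=
  tensor_deg i.+1 j *m tensor_diff i.

Definition tor_dim (i : nat) (j : int) : nat :=
  (\rank (tensor_cycles i j) - \rank (tensor_boundaries i j))%N.

End Tor.

(* The dimension of Tor_i(S/I, F)_j, computed from a chosen resolution of S/I,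
   which exists for every homogeneous I. *)
Definition graded_betti (I : ideal S) (i : nat) (j : int) : nat :=
  if pselect (exists C, resolves C I) is left exC
  then tor_dim (projT1 (cid exC)) i j else 0%N.

Definition generated_in_degree (s : nat) (I : ideal S) : Prop :=
  exists G : set S,
    (forall g, G g -> g \is s.-homog) /\ (I : set S) = ideal_gen G.

Definition s_linear_resolution (s : nat) (I : ideal S) : Prop :=
  generated_in_degree s I /\
  forall (i : nat) (j : int),
    (1 <= i)%N -> j <> s%:Z + i%:Z - 1 -> graded_betti I i j = 0%N.

Definition linear_resolution (I : ideal S) : Prop :=
  exists s : nat, (1 <= s)%N /\ s_linear_resolution s I.

End GradedBettiNumbers.

Section StanleyReisner.
Variables (F : fieldType) (n : nat) (Delta : {set {set 'I_n}}).

Definition sr_ideal : ideal {mpoly F[n]} :=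
  ideal_gen (fun p => exists2 A : {set 'I_n},
    A \notin Delta & p = \prod_(v in A) 'X_v).

Definition sr_ring : comPzRingType := quotient_ring sr_ideal.

End StanleyReisner.

Section TotalCutComplex.
Variables (V : finType) (e : rel V).

Definition independent (M : {set V}) : bool :=
  [forall u in M, forall v in M, ~~ e u v].

Definition total_cut_complex (k : nat) : {set {set V}} :=
  [set A : {set V} | [exists M : {set V},
     [&& independent M, #|M| == k & A \subset ~: M]]]%SET.

End TotalCutComplex.

(* The vertices 1, ..., n are represented by 0, ..., n - 1. *)
Definition cycle_square (n : nat) : rel 'I_n := fun u v =>
  [|| v == u + 1 %[mod n], v == u + 2 %[mod n],
      u == v + 1 %[mod n] | u == v + 2 %[mod n]]%N.

(* Main.v *)
Require Import Defs.
From mathcomp Require Import all_boot all_order all_algebra.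
From mathcomp Require Import boolp classical_sets mpoly.
From mathcomp Require Import ssrcomplements zify ring.

(** Write [S] for the polynomial ring in [n] variables and [I] for the
    Stanley-Reisner ideal.  A set of vertices is a nonface of the complex exactly
    when it meets every independent pair, that is, when its complement is a
    clique of the square of the cycle; so [I] is generated by the squarefree
    monomials whose complementary sets are the maximal cliques.

    For [n > 6] the maximal cliques are the [n] windows {i, i+1, i+2}.  They form
    a band around the cycle: the generator [g_i] of degree [n - 3] attached to
    the window at [i] satisfies x_i g_i = x_(i+3) g_(i+1), these [n] relations
    generate all relations, and because the band closes up they satisfy one
    relation themselves, with coefficients x_(i+1) x_(i+2).  This gives the
    minimal resolution [band_resolution]
      0 -> S(-n) -> S(-(n-2))^n -> S(-(n-3))^n -> I -> 0,
    whose last step has degree 2 and is therefore not linear.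

    For [n = 6] the graph is the octahedron, its independent pairs are the three
    antipodal pairs, and [I] is the product of the three ideals (x_i, x_(i+3)).
    Multiplying an ideal by (x, y), for two fresh variables, turns a linear
    resolution into a linear resolution by an explicit mapping cone
    ([prod_resolution]); doing this three times, starting from the unit ideal,
    gives the Betti numbers ([covers_resolution]).

    Graded Betti numbers may be read off from these resolutions because any two
    graded resolutions are homotopy equivalent ([tor_dim_resolution]).

    The ring is not Cohen-Macaulay because its resolution is longer than its
    codimension 2: the length [p] is 3 for [n > 6] and 4 for [n = 6].  This uses
    the half of the Auslander-Buchsbaum formula which says that the depth at the
    origin is at most [n - p], proved here with Koszul cohomology.  A regular
    sequence of length [r] in the ideal generated by the variables makes the
    Koszul cohomology of the variables vanish in degrees below [r]
    ([kos_exact_regular]).  If it vanished in degree [n - p] for the local ring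
    of [S / I] at the origin, then shifting dimensions along the resolution would
    trivialize the class of a basis vector of the last free module in top degree
    [n], which is impossible since Koszul coboundaries have their values in the
    ideal of the variables ([resolution_not_locally_exact]).  On the other hand,
    [I] is contained in (x_u, x_v) for any independent pair {u, v}, so that
    adding the other variables one by one gives a chain of primes of length
    [n - 2] in the local ring ([prime_chain_ex]). *)

Set Implicit Arguments.
Unset Strict Implicit.
Unset Printing Implicit Defensive.

Import GRing.Theory.

(** * Generated ideals *)

Section IdealGen.
Local Open Scope ring_scope.
Local Open Scope classical_set_scope.
Variable R : comPzRingType.

Lemma idealB (I : ideal R) x y : I x -> I y -> I (x - y).
Proof. by move=> Ix Iy; apply: ideal_add => //; rewrite -mulN1r; apply: ideal_mul. Qed.

Lemma ideal_genW (G : set R) x : G x -> ideal_gen G x.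
Proof. by move=> Gx J; apply. Qed.

Lemma ideal_gen_le (G : set R) (I : ideal R) : G `<=` I -> ideal_gen G `<=` I.
Proof. by move=> GI x; apply. Qed.

Lemma ideal_gen_mono (G H : set R) : G `<=` H -> ideal_gen G `<=` ideal_gen H.
Proof. by move=> GH; apply: ideal_gen_le => x /GH; exact: ideal_genW. Qed.

Lemma ideal_gen0 (G : set R) x : (forall y, ~ G y) -> ideal_gen G x -> x = 0.
Proof.
move=> G0.
have ZD (u v : R) : u = 0 -> v = 0 -> u + v = 0 by move=> -> ->; rewrite addr0.
have ZM (c u : R) : u = 0 -> c * u = 0 by move=> ->; rewrite mulr0.
pose Z : ideal R := @Ideal R (fun u => u = 0) erefl ZD ZM.
by apply: (ideal_gen_le (I:=Z)) => y /G0.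
Qed.

(** Used to strip one generator at a time off a finitely generated ideal. *)
Lemma ideal_gen_adjoin (G H : set R) x y :
  (forall g, G g -> g = x \/ H g) -> ideal_gen G y ->
  exists a, ideal_gen H (y - a * x).
Proof.
move=> GH.
pose T : set R := fun u => exists a, ideal_gen H (u - a * x).
have T0 : T 0 by exists 0; rewrite mul0r subr0; exact: ideal_has0.
have TD u v : T u -> T v -> T (u + v).
  move=> [a Ha] [b Hb]; exists (a + b).
  by have := ideal_add Ha Hb; congr (ideal_gen H _); ring.
have TM c u : T u -> T (c * u).
  move=> [a Ha]; exists (c * a).
  by have := ideal_mul c Ha; congr (ideal_gen H _); ring.
pose J : ideal R := Ideal T0 TD TM.
apply: (ideal_gen_le (I:=J)) => g /GH[->|Hg].
  by exists 1; rewrite mul1r subrr; exact: ideal_has0.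
by exists 0; rewrite mul0r subr0; exact: ideal_genW.
Qed.

End IdealGen.

(** * Homogeneous polynomials and graded matrices *)

Section Degrees.
Local Open Scope ring_scope.
Variables (F : fieldType) (n : nat).
Local Notation S := {mpoly F[n]}.
Implicit Types (p q : S) (d e : int) (P : pred 'X_{1..n}).

Definition homdeg d p := forall m, m \in msupp p -> (mdeg m)%:Z = d.

(** The part of a polynomial on the monomials selected by [P].  It serves both for
    homogeneous components and for setting variables to zero. *)
Definition mpart P p : S := \sum_(m <- msupp p | P m) p@_m *: 'X_[m].

Lemma mcoeff_mpart P p m : (mpart P p)@_m = if P m then p@_m else 0.
Proof.
rewrite /mpart raddf_sum /= big_mkcond /=.
transitivity (\sum_(k <- msupp p) if k == m then (if P m then p@_m else 0) else 0).
  apply: eq_bigr => k _; case: (eqVneq k m) => [->|km].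
    by case: ifP => // _; rewrite mcoeffZ mcoeffX eqxx mulr1.
  by case: ifP => // _; rewrite mcoeffZ mcoeffX (negPf km) mulr0.
have [mp|mp] := boolP (m \in msupp p).
  by rewrite (bigD1_seq m) //= eqxx big1 ?addr0 // => i /negPf ->.
by rewrite (memN_msupp_eq0 mp) if_same big1 // => k _; exact: if_same.
Qed.

(** Degrees are integers because generators of a resolution may have any degree;
    a component of negative degree is zero. *)
Definition hpart d := mpart (fun m => (mdeg m)%:Z == d).

Lemma mcoeff_hpart d p m :
  (hpart d p)@_m = if (mdeg m)%:Z == d then p@_m else 0.
Proof. exact: mcoeff_mpart. Qed.

Lemma hpartD d p q : hpart d (p + q) = hpart d p + hpart d q.
Proof.
by apply/mpolyP=> m; rewrite mcoeffD !mcoeff_hpart mcoeffD; case: ifP; rewrite ?addr0.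
Qed.

Lemma hpart0 d : hpart d 0 = 0.
Proof. by apply/mpolyP=> m; rewrite mcoeff_hpart mcoeff0 if_same. Qed.

Lemma hpartB d p q : hpart d (p - q) = hpart d p - hpart d q.
Proof.
by apply/mpolyP=> m; rewrite mcoeffB !mcoeff_hpart mcoeffB; case: ifP; rewrite ?subr0.
Qed.

Lemma hpart_sum d (T : finType) (f : T -> S) :
  hpart d (\sum_i f i) = \sum_i hpart d (f i).
Proof. exact: (big_morph (hpart d) (hpartD d) (hpart0 d)). Qed.

Lemma homdeg_hpart d p : homdeg d (hpart d p).
Proof.
move=> m; rewrite mcoeff_msupp mcoeff_hpart.
by case: ifP => [/eqP //|]; rewrite eqxx.
Qed.

Lemma hpart_id d p : homdeg d p -> hpart d p = p.
Proof.
move=> hp; apply/mpolyP=> m; rewrite mcoeff_hpart; case: ifP => // md.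
apply/esym/memN_msupp_eq0/negP => /hp /eqP; by rewrite md.
Qed.

(** Multiplication by a homogeneous element of degree [e] shifts components by
    [e]; this is what makes every lift below replaceable by a homogeneous one. *)
Lemma hpartM d e p q : homdeg e q -> hpart (d + e) (p * q) = hpart d p * q.
Proof.
move=> hq; apply/mpolyP=> m; rewrite mcoeff_hpart !mcoeffM.
case: ifP => md.
  apply: eq_bigr => -[k l] /= /eqP mkl; rewrite mcoeff_hpart.
  have [lq|/memN_msupp_eq0 ->] := boolP (val l \in msupp q); last by rewrite !mulr0.
  have := congr1 (fun m => (mdeg m)%:Z) mkl.
  by rewrite /= mdegD PoszD (hq _ lq) (eqP md) => /addIr <-; rewrite eqxx.
rewrite big1 // => -[k l] /= /eqP mkl; rewrite mcoeff_hpart.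
have [lq|/memN_msupp_eq0 ->] := boolP (val l \in msupp q); last by rewrite !mulr0.
case: ifP => [/eqP kd|]; last by rewrite mul0r.
have := congr1 (fun m => (mdeg m)%:Z) mkl.
by rewrite /= mdegD PoszD kd (hq _ lq) => mde; rewrite mde eqxx in md.
Qed.

Lemma homdeg0 d : homdeg d 0.
Proof. by move=> m; rewrite msupp0. Qed.

Lemma homdegD d p q : homdeg d p -> homdeg d q -> homdeg d (p + q).
Proof. by move=> hp hq m /msuppD_le; rewrite mem_cat => /orP[/hp|/hq]. Qed.

Lemma homdegN d p : homdeg d p -> homdeg d (- p).
Proof. by move=> hp m; rewrite (perm_mem (msuppN p)) => /hp. Qed.

Lemma homdegM d e p q : homdeg d p -> homdeg e q -> homdeg (d + e) (p * q).
Proof.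
move=> hp hq m /msuppM_le /allpairsP[[k l] /= [/hp kd /hq le ->]].
by rewrite mdegD PoszD kd le.
Qed.

Lemma homdegX i : homdeg 1 'X_i.
Proof. by move=> k; rewrite msuppX inE => /eqP ->; rewrite mdeg1. Qed.

Lemma homdeg1 : homdeg 0 1.
Proof. by move=> m; rewrite msupp1 inE => /eqP ->; rewrite mdeg0. Qed.

Lemma homdeg_sum d (T : finType) (f : T -> S) :
  (forall i, homdeg d (f i)) -> homdeg d (\sum_i f i).
Proof. by move=> hf; elim/big_ind: _ => //; [exact: homdeg0|exact: homdegD]. Qed.

(** The condition that the map of free modules sending the basis vectors of
    degrees [da] to combinations of those of degrees [db] preserves degrees. *)
Definition hommx (p q : nat) (da : 'I_p -> int) (db : 'I_q -> int) (M : 'M[S]_(p, q)) :=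
  forall a b, homdeg (da a - db b) (M a b).

Lemma hommxM (p q r : nat) (da : 'I_p -> int) (db : 'I_q -> int) (dc : 'I_r -> int) M N :
  hommx da db M -> hommx db dc N -> hommx da dc (M *m N).
Proof.
move=> hM hN a c; rewrite mxE; apply: homdeg_sum => b.
have -> : da a - dc c = (da a - db b) + (db b - dc c) by rewrite addrA subrK.
exact: homdegM.
Qed.

Lemma hommxB (p q : nat) (da : 'I_p -> int) (db : 'I_q -> int) M N :
  hommx da db M -> hommx da db N -> hommx da db (M - N).
Proof. by move=> hM hN a b; rewrite !mxE; apply: homdegD => //; apply: homdegN. Qed.

Lemma hommx1 (p : nat) (da : 'I_p -> int) : hommx da da 1%:M.
Proof.
move=> a b; rewrite mxE; case: eqP => [->|_]; last exact: homdeg0.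
by rewrite subrr; exact: homdeg1.
Qed.

(** Rows that lift through a graded map lift to a graded matrix: take arbitrary
    lifts and keep, in each entry, only the component of the right degree. *)
Lemma hommx_lift (p q r : nat) (da : 'I_p -> int) (db : 'I_q -> int) (dc : 'I_r -> int)
    (V : 'M[S]_(p, r)) (A : 'M[S]_(q, r)) :
  hommx da dc V -> hommx db dc A ->
  (forall a, exists w, row a V = w *m A) ->
  exists W, hommx da db W /\ V = W *m A.
Proof.
move=> hV hA /fin_all_exists[w wP].
exists (\matrix_(a, b) hpart (da a - db b) (w a 0 b)); split.
  by move=> a b; rewrite mxE; exact: homdeg_hpart.
apply/matrixP=> a c; rewrite mxE.
have /matrixP/(_ 0 c) := wP a; rewrite !mxE => Vac.
rewrite -(hpart_id (hV a c)) Vac hpart_sum; apply: eq_bigr => b _.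
rewrite mxE -(hpartM _ _ (hA b c)); congr (hpart _ _).
by rewrite addrA subrK.
Qed.

Lemma map_mcoeff0M (p q r : nat) (M : 'M[S]_(p, q)) (N : 'M[S]_(q, r)) :
  map_mx (mcoeff 0%MM) (M *m N) = map_mx (mcoeff 0%MM) M *m map_mx (mcoeff 0%MM) N.
Proof. exact: map_mxM. Qed.

(** Modulo the variables, a graded matrix only relates basis vectors of equal
    degree, so it commutes with the projections onto a given degree. *)
Lemma hommx_deg (p q : nat) (da : 'I_p -> int) (db : 'I_q -> int) M j :
  hommx da db M ->
  diag_mx (\row_a (da a == j)%:R) *m map_mx (mcoeff 0%MM) M =
  map_mx (mcoeff 0%MM) M *m diag_mx (\row_b (db b == j)%:R).
Proof.
move=> hM; apply/matrixP=> a b; rewrite mul_diag_mx mul_mx_diag !mxE.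
have [s|/memN_msupp_eq0 ->] := boolP (0%MM \in msupp (M a b)); last by rewrite mulr0 mul0r.
have := hM a b _ s; rewrite mdeg0 => /esym/eqP; rewrite subr_eq0 => /eqP ->.
by rewrite mulrC.
Qed.

End Degrees.

(** * Tor does not depend on the graded resolution *)

Section Comparison.
Local Open Scope ring_scope.
Variables (F : fieldType) (n : nat).
Local Notation S := {mpoly F[n]}.
Local Notation cplx := (graded_free_complex F n).
Local Notation "M ^bar" := (map_mx (mcoeff 0%MM) M) (at level 2, format "M ^bar").
Local Notation diff := gfc_diff.
Local Notation rk := gfc_rank.

Lemma hommx_diff (C : cplx) i :
  hommx (gfc_deg (g:=C) (i:=i.+1)) (gfc_deg (g:=C) (i:=i)) (diff C i).
Proof. by move=> a b m /gfc_homog <-; rewrite addrK. Qed.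

Variable I : ideal S.
Hypothesis I_hom : forall d p, I p -> I (hpart d p).

(** The content of [resolves] for a fixed augmentation [eps]. *)
Definition augmented (C : cplx) (eps : 'cV[S]_(rk C 0)) :=
  [/\ forall a m, m \in msupp (eps a 0) -> (mdeg m)%:Z = gfc_deg a,
        forall q : quotient_ring I, exists v : 'rV_(rk C 0),
          q = quotient_proj I ((v *m eps) 0 0),
        forall v : 'rV_(rk C 0),
          quotient_proj I ((v *m eps) 0 0) = 0 <->
          exists w, v = w *m diff C 0 &
        forall i (v : 'rV_(rk C i.+1)),
          v *m diff C i = 0 <-> exists w, v = w *m diff C i.+1].

(** The kernel of the map out of the [i]-th module, where the map out of the
    zeroth one goes to the quotient by [I]. *)
Definition aker (C : cplx) (eps : 'cV[S]_(rk C 0)) i : 'rV[S]_(rk C i) -> Prop :=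
  match i with
  | 0 => fun v => I ((v *m eps) 0 0)
  | i'.+1 => fun v => v *m diff C i' = 0
  end.

Lemma proj0P p : quotient_proj I p = 0 <-> I p.
Proof.
by rewrite -(raddf0 (quotient_proj I)) quotient_proj_eq subr0.
Qed.

Lemma akerP C eps i (v : 'rV_(rk C i)) : augmented eps ->
  aker eps v <-> exists w, v = w *m diff C i.
Proof. by case: i v => [|i] v [_ _ e0 e1] /=; [rewrite -proj0P|]. Qed.

(** The kernel of the map out of the [i]-th module after tensoring with the field;
    the augmentation is discarded there. *)
Definition zker (C : cplx) i p : 'M[F]_(p, rk C i) -> Prop :=
  match i with
  | 0 => fun=> True
  | i'.+1 => fun v => v *m tensor_diff C i' = 0
  end.

(** One stage of a homotopy equivalence between two resolutions, phrased so that
    stages can be built one after the other: [f] and [g] are the two chain maps and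
    [h] the homotopy between their composite and the identity, restricted to
    kernels, where the term of the homotopy coming from the previous stage
    vanishes.  The last two clauses say the same after tensoring with the field. *)
Definition chain_equiv (C D : cplx) epsC epsD i
    (f : 'M[S]_(rk C i, rk D i)) (g : 'M[S]_(rk D i, rk C i))
    (h : 'M[S]_(rk C i, rk C i.+1)) : Prop :=
  [/\ [/\ hommx (gfc_deg (i:=i)) (gfc_deg (i:=i)) f,
          hommx (gfc_deg (i:=i)) (gfc_deg (i:=i)) g &
          hommx (gfc_deg (i:=i)) (gfc_deg (i:=i.+1)) h],
      [/\ forall v, aker epsC v -> aker epsD (v *m f),
          forall v, aker epsD v -> aker epsC (v *m g) &
          forall v, aker epsC v -> v - v *m (f *m g) = v *m (h *m diff C i)],
      forall p (z : 'M_(p, _)), zker z -> @zker D i p (z *m f^bar) &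
      forall p (z : 'M_(p, _)), zker z ->
        z - z *m (f^bar *m g^bar) = z *m (h^bar *m tensor_diff C i)].

Lemma lift_diff (C D : cplx) epsC epsD i (f : 'M[S]_(rk C i, rk D i)) :
  augmented epsC -> augmented epsD ->
  hommx (gfc_deg (i:=i)) (gfc_deg (i:=i)) f ->
  (forall v, aker epsC v -> aker epsD (v *m f)) ->
  exists f' : 'M_(rk C i.+1, rk D i.+1),
    hommx (gfc_deg (i:=i.+1)) (gfc_deg (i:=i.+1)) f' /\
    diff C i *m f = f' *m diff D i.
Proof.
move=> aC aD hf kf; apply: hommx_lift; last 1 first.
- move=> a; apply/(akerP _ aD); rewrite row_mul; apply: kf.
  by apply/(akerP _ aC); exists (delta_mx 0 a); rewrite rowE.
- apply: hommxM hf; exact: hommx_diff.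
- exact: hommx_diff.
Qed.

(** The usual inductive step of the comparison theorem: by exactness, the chain
    maps and the homotopy extend over the next free module, since its basis is sent
    to kernels. *)
Lemma chain_equivS (C D : cplx) epsC epsD i f g h :
  augmented epsC -> augmented epsD ->
  @chain_equiv C D epsC epsD i f g h ->
  exists f' g' h', [/\ diff C i *m f = f' *m diff D i,
    diff D i *m g = g' *m diff C i &
    @chain_equiv C D epsC epsD i.+1 f' g' h'].
Proof.
move=> aC aD [[hf hg hh] [kf kg kh] _ _].
have [f' [hf' ff']] := lift_diff aC aD hf kf.
have [g' [hg' gg']] := lift_diff aD aC hg kg.
(* the rows of V are cycles, and their lift is the next homotopy *)
pose V := 1%:M - f' *m g' - diff C i *m h.
have hV : hommx (gfc_deg (i:=i.+1)) (gfc_deg (i:=i.+1)) V.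
  apply: hommxB; first by apply: hommxB; [exact: hommx1|exact: hommxM hg'].
  by apply: hommxM hh; exact: hommx_diff.
have VD : V *m diff C i = 0.
  rewrite /V !mulmxBl mul1mx -!mulmxA -gg' (mulmxA f') -ff'.
  apply/row_matrixP=> a; rewrite row0 !raddfB /= !row_mul.
  have /kh : aker epsC (row a (diff C i)).
    by apply/(akerP _ aC); exists (delta_mx 0 a); rewrite rowE.
  by rewrite !mulmxA => ->; rewrite subrr.
have [|h' [hh' Vh']] := hommx_lift hV (@hommx_diff C i.+1).
  move=> a; apply/(akerP (eps:=epsC) (i:=i.+1) _ aC) => /=.
  by rewrite -row_mul VD row0.
have f'f : f'^bar *m tensor_diff D i = tensor_diff C i *m f^bar.
  by rewrite /tensor_diff -!map_mcoeff0M ff'.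
exists f', g', h'; split => //; split=> //=.
- split=> [v vD|v vD|v vD] /=.
  + by rewrite -mulmxA -ff' mulmxA vD mul0mx.
  + by rewrite -mulmxA -gg' mulmxA vD mul0mx.
  + rewrite -Vh' /V !mulmxBr mulmx1 !mulmxA vD mul0mx subr0 //.
- by move=> p z zD; rewrite -mulmxA f'f mulmxA zD mul0mx.
- move=> p z zD; rewrite /tensor_diff -!map_mcoeff0M -Vh' /V !raddfB /= !map_mcoeff0M map_mx1.
  by rewrite mulmx1 (mulmxA z _^bar h^bar) [z *m (diff C i)^bar]zD mul0mx subr0.
Qed.

(** Generators of the target of one augmentation are lifted through the other one;
    the homogeneity of [I] allows the lifts to be chosen homogeneous. *)
Lemma chain_equiv0 (C D : cplx) epsC epsD :
  augmented epsC -> augmented epsD ->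
  exists f g h, @chain_equiv C D epsC epsD 0 f g h.
Proof.
have lift0 (A B : cplx) (eA : 'cV_(rk A 0)) (eB : 'cV_(rk B 0)) :
    augmented eA -> augmented eB ->
    exists f : 'M[S]_(rk A 0, rk B 0),
      hommx (gfc_deg (i:=0)) (gfc_deg (i:=0)) f /\
      forall v : 'rV_(rk A 0), I ((v *m eA - v *m f *m eB) 0 0).
  move=> [hA _ _ _] [hB sB _ _].
  have /fin_all_exists[w wP] a : exists w : 'rV_(rk B 0), I (eA a 0 - (w *m eB) 0 0).
    by have [w /quotient_proj_eq] := sB (quotient_proj I (eA a 0)); exists w.
  pose f := \matrix_(a, b) hpart (gfc_deg a - gfc_deg b) (w a 0 b).
  exists f; split=> [a b|v]; first by rewrite mxE; exact: homdeg_hpart.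
  have fP a : I (eA a 0 - (f *m eB) a 0).
    have := I_hom (gfc_deg a) (wP a); rewrite hpartB (hpart_id (d:=gfc_deg a)); last exact: hA.
    congr (I (_ - _)); rewrite !mxE hpart_sum; apply: eq_bigr => b _.
    by rewrite mxE -(@hpartM _ _ _ (gfc_deg b)) ?subrK //; exact: hB.
  rewrite -mulmxA -mulmxBr mxE.
  elim/big_ind: _ => [|x y|a _]; first exact: ideal_has0.
    exact: ideal_add.
  by rewrite !mxE; apply: ideal_mul; have := fP a; rewrite mxE.
move=> aC aD.
have [f [hf fP]] := lift0 _ _ _ _ aC aD.
have [g [hg gP]] := lift0 _ _ _ _ aD aC.
have IB x y : I x -> I (x - y) -> I y.
  by move=> Ix Ixy; rewrite -(subKr x y); exact: idealB.
have hV : hommx (gfc_deg (i:=0)) (gfc_deg (i:=0)) (1%:M - f *m g).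
  by apply: hommxB; [exact: hommx1|exact: hommxM hg].
have [|h [hh hP]] := hommx_lift hV (@hommx_diff C 0).
  move=> a; apply/(akerP (eps:=epsC) (i:=0) _ aC) => /=.
  have := fP (delta_mx 0 a); have := gP (delta_mx 0 a *m f).
  rewrite [row _ _]rowE mulmxBr mulmx1 mulmxBl mulmxA.
  set x := _ *m epsD; set y := _ *m g *m _; set u := _ *m epsC.
  move=> I1 I2; have := ideal_add I2 I1; rewrite !mxE.
  by rewrite addrA subrK.
exists f, g, h; split=> //.
- split=> /= v Iv.
  + by apply: IB Iv _; have := fP v; rewrite !mxE.
  + by apply: IB Iv _; have := gP v; rewrite !mxE.
  + by rewrite -hP mulmxBr mulmx1.
- move=> p z _; rewrite /tensor_diff -!map_mcoeff0M -hP !raddfB /= map_mx1.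
  by rewrite map_mcoeff0M mulmx1.
Qed.

Lemma chain_equiv_ex (C D : cplx) epsC epsD i :
  augmented epsC -> augmented epsD ->
  exists f g h, @chain_equiv C D epsC epsD i f g h.
Proof.
move=> aC aD; elim: i => [|i [f [g [h /(chain_equivS aC aD)]]]].
  exact: chain_equiv0.
by case=> f' [g' [h' [_ _ e]]]; exists f', g', h'.
Qed.

Lemma tensor_cyclesP (C : cplx) i j p (z : 'M_(p, rk C i)) :
  (z <= tensor_cycles C i j)%MS <-> (z <= tensor_deg C i j)%MS /\ zker z.
Proof.
case: i z => [|i] z /=; first by split=> // -[].
by rewrite sub_capmx; split=> [/andP[-> /sub_kermxP]|[-> /sub_kermxP]].
Qed.

Lemma tensor_degM (C D : cplx) i k (f : 'M[S]_(rk C i, rk D k)) j :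
  hommx (gfc_deg (i:=i)) (gfc_deg (i:=k)) f ->
  tensor_deg C i j *m f^bar = f^bar *m tensor_deg D k j.
Proof. exact: hommx_deg. Qed.

Lemma diff_diff (C : cplx) (eps : 'cV_(rk C 0)) i :
  augmented eps -> diff C i.+1 *m diff C i = 0.
Proof.
move=> aC; apply/row_matrixP=> a; rewrite row0 row_mul.
apply: (proj2 (akerP (eps:=eps) (i:=i.+1) _ aC)).
by exists (delta_mx 0 a); rewrite rowE.
Qed.

Lemma tensor_boundaries_cycles (C : cplx) (eps : 'cV_(rk C 0)) i j :
  augmented eps -> (tensor_boundaries C i j <= tensor_cycles C i j)%MS.
Proof.
move=> aC; apply/tensor_cyclesP; split.
  rewrite /tensor_boundaries /tensor_diff (tensor_degM _ (@hommx_diff C i)).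
  exact: submxMl.
case: i => [//|i] /=; rewrite /tensor_diff /tensor_boundaries -mulmxA.
by rewrite -map_mcoeff0M (diff_diff _ aC) map_mx0 mulmx0.
Qed.

(** If [z] is a cycle whose image under [f] is a boundary, then applying [g] and the
    homotopy shows that [z] is a boundary; so [f] is injective on homology.  The
    inequality of dimensions is rank-nullity for [f] followed by the cokernel of the
    boundaries. *)
Lemma tor_dim_le (C D : cplx) (epsC : 'cV_(rk C 0)) (epsD : 'cV_(rk D 0)) i j :
  augmented epsC -> augmented epsD -> (tor_dim C i j <= tor_dim D i j)%N.
Proof.
move=> aC aD; have [f [g [h e]]] := chain_equiv_ex i aC aD.
have [f' [g' [h' [_ gg' [[_ hg' _] _ _ _]]]]] := chain_equivS aC aD e.
have [[hf hg hh] _ zf zh] := e.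
pose ZC := tensor_cycles C i j; pose ZD := tensor_cycles D i j.
pose BC := tensor_boundaries C i j; pose BD := tensor_boundaries D i j.
have degf p (z : 'M_(p, _)) : (z <= tensor_deg C i j)%MS -> (z *m f^bar <= tensor_deg D i j)%MS.
  by move=> /submxP[w ->]; rewrite -mulmxA tensor_degM // mulmxA submxMl.
have ZCD : (ZC *m f^bar <= ZD)%MS.
  have /tensor_cyclesP[z1 z2] : (ZC <= tensor_cycles C i j)%MS by [].
  by apply/tensor_cyclesP; split; [exact: degf|exact: zf].
have BDC p (z : 'M_(p, _)) : (z <= BD)%MS -> (z *m g^bar <= BC)%MS.
  move=> /submxP[w ->]; rewrite /BD /BC /tensor_boundaries -!mulmxA /tensor_diff.
  by rewrite -map_mcoeff0M gg' map_mcoeff0M (mulmxA (tensor_deg _ _ _)) tensor_degM // !mulmxA -(mulmxA (w *m _)) submxMl.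
have ZB p (z : 'M_(p, _)) : (z <= ZC)%MS -> (z *m f^bar <= BD)%MS -> (z <= BC)%MS.
  move=> /tensor_cyclesP[/submxP[w zw] /zh zE] /BDC zg.
  rewrite -(subrK (z *m (f^bar *m g^bar)) z); apply: addmx_sub; last by rewrite mulmxA.
  rewrite zE zw -!mulmxA (mulmxA (tensor_deg _ _ _)) tensor_degM // -mulmxA mulmxA.
  by rewrite mulmxA -[X in (X <= _)%MS]mulmxA submxMl.
rewrite /tor_dim -/ZC -/ZD -/BC -/BD.
pose M := f^bar *m cokermx BD.
have rC := mxrank_mul_ker ZC M.
have rD := mxrank_mul_ker ZD (cokermx BD).
have kC : (\rank (ZC :&: kermx M)%MS <= \rank BC)%N.
  apply: mxrankS; apply: ZB; first exact: capmxSl.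
  rewrite submxE -mulmxA -/M; apply/eqP/sub_kermxP; exact: capmxSr.
have kD : (\rank (ZD :&: kermx (cokermx BD))%MS <= \rank BD)%N.
  by apply: mxrankS; rewrite submxE; apply/eqP/sub_kermxP; exact: capmxSr.
have BZ : (BD <= ZD)%MS := tensor_boundaries_cycles i j aD.
have rr : (\rank (ZC *m M) <= \rank (ZD *m cokermx BD))%N.
  by rewrite /M mulmxA; apply: mxrankS; exact: submxMr.
have kD' : \rank (ZD :&: kermx (cokermx BD))%MS = \rank BD.
  apply/eqP; rewrite eqn_leq kD; apply: mxrankS; rewrite sub_capmx BZ.
  by apply/sub_kermxP; rewrite mulmx_coker.
lia.
Qed.

Theorem tor_dim_resolution (C : cplx) i j :
  resolves C I -> graded_betti I i j = tor_dim C i j.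
Proof.
move=> rC; rewrite /graded_betti; case: pselect => [exC|[]]; last by exists C.
case: (cid exC) => D rD /=; have [epsC aC] := rC; have [epsD aD] := rD.
by apply/eqP; rewrite eqn_leq (tor_dim_le _ _ aC aD) (tor_dim_le _ _ aD aC).
Qed.

End Comparison.

(** * Monomial ideals *)

Section MonomialIdeals.
Local Open Scope ring_scope.
Local Open Scope classical_set_scope.
Variables (F : fieldType) (n : nat).
Local Notation S := {mpoly F[n]}.
Local Notation mnm := 'X_{1..n}.
Implicit Types (p q : S) (m k : mnm) (Q : mnm -> Prop) (K : set mnm).

(** The polynomials supported on [Q] form an ideal when [Q] is closed under
    multiples; all monomial ideals are handled in this form. *)
Definition supported Q p := forall m, m \in msupp p -> Q m.

Definition upclosed Q := forall m k, Q m -> Q (m + k)%MM.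

Lemma supported0 Q : supported Q 0.
Proof. by move=> m; rewrite msupp0. Qed.

Lemma supportedD Q p q : supported Q p -> supported Q q -> supported Q (p + q).
Proof. by move=> hp hq m /msuppD_le; rewrite mem_cat => /orP[/hp|/hq]. Qed.

Lemma supportedM Q p q : upclosed Q -> supported Q q -> supported Q (p * q).
Proof.
move=> uQ hq m /msuppM_le /allpairsP[[k l] /= [_ /hq lq ->]].
by rewrite addmC; apply: uQ.
Qed.

Lemma msupp_mulX p k m : (k + m)%MM \in msupp (p * 'X_[k]) = (m \in msupp p).
Proof. by rewrite !mcoeff_msupp mcoeffMX. Qed.

Lemma msupp_mulXP p k m :
  m \in msupp (p * 'X_[k]) -> exists2 m', m' \in msupp p & m = (k + m')%MM.
Proof. by rewrite (perm_mem (msuppMX _ _)) => /mapP. Qed.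

Lemma supported_divX p k :
  supported (fun m => (k <= m)%MM) p -> exists q, p = q * 'X_[k].
Proof.
move=> pk; exists (\sum_(m <- msupp p) p@_m *: 'X_[m - k]).
rewrite mulr_suml {1}[p]mpolyE !big_seq; apply: eq_bigr => m /pk km.
by rewrite -scalerAl -mpolyXD submK.
Qed.

Definition up K : mnm -> Prop := fun m => exists2 k, K k & (k <= m)%MM.

Lemma up_upclosed K : upclosed (up K).
Proof.
move=> m l [k Kk km]; exists k => //; apply: lepm_trans km _.
by apply/mnm_lepP=> i; rewrite mnmDE leq_addr.
Qed.

Lemma monomial_idealP K p :
  ideal_gen ((fun k => 'X_[k]) @` K) p <-> supported (up K) p.
Proof.
split.
  pose J : ideal S := Ideal (@supported0 (up K)) (@supportedD (up K))
    (fun p q => @supportedM (up K) p q (@up_upclosed K)).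
  apply: (ideal_gen_le (I:=J)) => _ [k Kk <-] m; rewrite msuppX inE => /eqP ->.
  by exists k => //; exact: lepm_refl.
move=> hp; rewrite [p]mpolyE big_seq.
elim/big_ind: _ => [|x y|m /hp[k Kk km]]; first exact: ideal_has0.
  exact: ideal_add.
rewrite -(submK km) mpolyXD scalerAl; apply: ideal_mul; apply: ideal_genW.
by exists k.
Qed.

Definition vars m : {set 'I_n} := [set i | (0 < m i)%N].

(** The nonfaces are closed under supersets, so a multiple of the monomial of a
    nonface is a monomial whose support is again a nonface. *)
Lemma sr_idealP (Delta : {set {set 'I_n}}) p :
  (forall A B : {set 'I_n}, A \subset B -> B \in Delta -> A \in Delta) ->
  sr_ideal F Delta p <-> supported (fun m => vars m \notin Delta) p.
Proof.
move=> down; pose ind (A : {set 'I_n}) : mnm := [multinom nat_of_bool (i \in A) | i < n].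
have indX (A : {set 'I_n}) : \prod_(v in A) 'X_v = 'X_[ind A] :> S.
  rewrite (mpolyXE_id _ (ind A)) big_mkcond; apply: eq_bigr => i _.
  by rewrite mnmE; case: ifP.
have -> : sr_ideal F Delta p = ideal_gen ((fun k => 'X_[k]) @` (ind @` [set A : {set 'I_n} | A \notin Delta])) p :> Prop.
  congr (ideal_gen _ p); rewrite predeqE => x; split.
    by move=> [A AD ->]; exists (ind A) => //; exists A.
  by move=> [_ [A AD <-] <-]; exists A.
rewrite monomial_idealP; split=> hp m /hp.
  move=> [_ [A /= AD <-] /mnm_lepP le]; apply: contra AD; apply: down.
  apply/fintype.subsetP=> i iA; rewrite inE; apply: leq_trans (le i).
  by rewrite mnmE iA.
move=> mD; exists (ind (vars m)); first by exists (vars m).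
by apply/mnm_lepP=> i; rewrite mnmE inE; case: (m i).
Qed.

Lemma mpolyXU_neq0 (i : 'I_n) : 'X_i != 0 :> S.
Proof.
by apply/eqP => /(congr1 (mcoeff U_(i)%MM)) /eqP; rewrite mcoeffX eqxx mcoeff0 oner_eq0.
Qed.

Lemma supported_hpart Q d p : supported Q p -> supported Q (hpart d p).
Proof.
move=> hp m; rewrite mcoeff_msupp mcoeff_hpart; case: ifP => _; last by rewrite eqxx.
by rewrite -mcoeff_msupp => /hp.
Qed.

Lemma mcoeff0E p q : (p * q)@_0%MM = p@_0%MM * q@_0%MM.
Proof. exact: (rmorphM (mcoeff 0%MM)). Qed.

End MonomialIdeals.

(** * Koszul cohomology and regular sequences *)

Section Koszul.
Local Open Scope ring_scope.
Variables (R : comPzRingType).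

Section Cochains.
Variable (V : lmodType R).
Implicit Types (xs bs : seq R) (c : bitseq -> V) (m : bitseq).

(** The Koszul differential for the sequence [xs].  A cochain assigns a vector to
    every boolean mask, that is, to every subset of [xs]; the differential is the
    one of the cone of multiplication by the head of [xs].  With recursion on
    [xs] the signs of exterior algebra take care of themselves. *)
Fixpoint kos xs c m : V :=
  match xs, m with
  | x :: xs', true :: m' =>
      x *: c (false :: m') - kos xs' (fun t => c (true :: t)) m'
  | x :: xs', false :: m' => kos xs' (fun t => c (false :: t)) m'
  | _, _ => 0
  end.

(** Contraction with the functional whose coordinates on the generators are [bs]. *)
Fixpoint contract xs bs c m : V :=
  match xs, bs, m with
  | _ :: xs', b :: bs', true :: m' =>
      - contract xs' bs' (fun t => c (true :: t)) m'
  | _ :: xs', b :: bs', false :: m' =>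
      b *: c (true :: m') + contract xs' bs' (fun t => c (false :: t)) m'
  | _, _, _ => 0
  end.

Lemma kosB xs c d m : kos xs (fun t => c t - d t) m = kos xs c m - kos xs d m.
Proof.
elim: xs c d m => [|x xs IH] c d [|[] m] /=; rewrite ?subr0 ?IH //.
by rewrite scalerBr !opprD !opprK addrACA.
Qed.

Lemma kosD xs c d m : kos xs (fun t => c t + d t) m = kos xs c m + kos xs d m.
Proof.
elim: xs c d m => [|x xs IH] c d [|[] m] /=; rewrite ?addr0 ?IH //.
by rewrite scalerDr opprD addrACA.
Qed.

Lemma kosZ xs a c m : kos xs (fun t => a *: c t) m = a *: kos xs c m.
Proof.
elim: xs c m => [|x xs IH] c [|[] m] /=; rewrite ?scaler0 ?IH //.
by rewrite scalerBr !scalerA mulrC.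
Qed.

Lemma kosN xs c m : kos xs (fun t => - c t) m = - kos xs c m.
Proof.
elim: xs c m => [|x xs IH] c [|[] m] /=; rewrite ?oppr0 ?IH //.
by rewrite scalerN opprD opprK.
Qed.

Lemma kos_kos xs c m : kos xs (kos xs c) m = 0.
Proof.
elim: xs c m => [|x xs IH] c [|[] m] //=.
by rewrite kosB kosZ IH subr0 subrr.
Qed.

Fixpoint dot xs bs : R :=
  match xs, bs with x :: xs', b :: bs' => b * x + dot xs' bs' | _, _ => 0 end.

(** The homotopy formula: contraction makes multiplication by the combination
    [dot xs bs] of [xs] null-homotopic, so that such elements act as zero on Koszul
    cohomology. *)
Lemma kos_homotopy xs bs c m : size bs = size xs -> size m = size xs ->
  kos xs (contract xs bs c) m + contract xs bs (kos xs c) m = dot xs bs *: c m.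
Proof.
elim: xs bs c m => [|x xs IH] [|b bs] c [|[] m] //=; rewrite ?scale0r ?addr0 //.
  have contractB ys as_ d e t :
      contract ys as_ (fun t => d t - e t) t = contract ys as_ d t - contract ys as_ e t.
    elim: ys as_ d e t => [|y ys IHy] [|a as_] d e [|[] t] /=; rewrite ?subr0 ?IHy //.
      by rewrite !opprD !opprK.
    by rewrite scalerBr !opprD addrACA.
  have contractZ ys as_ a d t :
      contract ys as_ (fun t => a *: d t) t = a *: contract ys as_ d t.
    elim: ys as_ d t => [|y ys IHy] [|a' as_] d [|[] t] /=; rewrite ?scaler0 ?IHy ?scalerN //.
    by rewrite scalerDr !scalerA mulrC.
  move=> [sb] [sm]; rewrite kosN contractB contractZ scalerDl.
  rewrite -(IH bs (fun t => c (true :: t))) // scalerDr scalerA (mulrC x b) opprK opprB.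
  set A := _ *: contract _ _ _ _; set B := contract _ _ _ _; set C := kos _ _ _.
  by rewrite -!addrA; congr (_ + _); rewrite addrC -!addrA addNr addr0.
move=> [sb] [sm]; rewrite kosD kosZ scalerDl.
rewrite -(IH bs (fun t => c (false :: t))) // scalerBr scalerA.
set A := _ *: _; set B := _ *: _; set C := kos _ _ _; set D := contract _ _ _ _.
by rewrite addrACA [A + _]addrC subrK.
Qed.

(** Cochains are not graded by type; a cochain of degree [k] is one that is only
    looked at on these masks. *)
Definition masks xs k := [pred m : bitseq | (size m == size xs) && (count id m == k)].

Definition submodule (L : V -> Prop) :=
  [/\ L 0, forall u v, L u -> L v -> L (u + v) & forall a u, L u -> L (a *: u)].

Lemma submoduleB L u v : submodule L -> L u -> L v -> L (u - v).
Proof. by case=> _ LD LZ Lu Lv; apply: LD => //; rewrite -scaleN1r; apply: LZ. Qed.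

Lemma kos0 xs c m : m \in masks xs 0 -> kos xs c m = 0.
Proof.
case/andP=> _ /eqP cm; have : ~~ has id m by rewrite has_count cm.
elim: xs m c {cm} => [|y ys IHy] [|[] m] d //= h; exact: IHy.
Qed.

Lemma kos_in (L : V -> Prop) xs c k :
  submodule L -> (forall m, m \in masks xs k -> L (c m)) ->
  forall m, m \in masks xs k.+1 -> L (kos xs c m).
Proof.
move=> sL; have [L0 _ LZ] := sL; elim: xs c k => [|x xs IH] c k Lc [|[] m] //=.
  rewrite inE /= eqSS add1n eqSS => /andP[sm cm]; apply: submoduleB => //.
    by apply/LZ/Lc; rewrite inE /= eqSS sm.
  case: k cm Lc => [|k] cm Lc.
    by rewrite kos0 // inE sm.
  apply: (IH _ k); last by rewrite inE sm.
  by move=> t /andP[st ct]; apply: Lc; rewrite inE /= eqSS st.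
rewrite inE /= eqSS => /andP[sm cm]; apply: (IH _ k); last by rewrite inE sm.
by move=> t /andP[st ct]; apply: Lc; rewrite inE /= eqSS st.
Qed.

Lemma contract_in (L : V -> Prop) xs bs c k :
  submodule L -> (forall m, m \in masks xs k.+1 -> L (c m)) ->
  forall m, m \in masks xs k -> L (contract xs bs c m).
Proof.
move=> sL; have [L0 LD LZ] := sL.
elim: xs bs c k => [|x xs IH] [|b bs] c k Lc [|[] m] //=.
  case: k Lc => [|k] Lc /andP[] //; rewrite ?inE /= ?add1n ?eqSS ?andbF // => sm cm.
  rewrite -scaleN1r; apply: LZ; apply: (IH _ _ k); last by rewrite inE sm.
  by move=> t /andP[st ct]; apply: Lc; rewrite inE /= eqSS st.
rewrite inE /= eqSS => /andP[sm cm]; apply: LD.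
  by apply/LZ/Lc; rewrite inE /= eqSS sm add1n eqSS.
apply: (IH _ _ k); last by rewrite inE sm.
by move=> t /andP[st ct]; apply: Lc; rewrite inE /= eqSS st.
Qed.

End Cochains.

Local Open Scope classical_set_scope.

Lemma ideal_gen_dot (xs : seq R) y : ideal_gen [set` xs] y ->
  exists2 bs, size bs = size xs & y = dot xs bs.
Proof.
elim: xs y => [|x xs IH] y.
  by move/ideal_gen0 => ->; [exists [::]|move=> z; rewrite /= in_nil].
move/(@ideal_gen_adjoin R _ [set` xs] x) => [].
  by move=> g /=; rewrite inE => /orP[/eqP|]; [left|right].
move=> a /IH[bs sbs E]; exists (a :: bs); rewrite /= ?sbs // -E.
by rewrite addrC subrK.
Qed.

Lemma submodule_ideal (J : ideal R) : @submodule R^o J.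
Proof. by split; [exact: ideal_has0|exact: (@ideal_add _ J)|exact: (@ideal_mul _ J)]. Qed.

(** Vanishing of the degree [k] Koszul cohomology of the quotient by [J]. *)
Definition kos_exact (xs : seq R) (J : ideal R) k :=
  forall c : bitseq -> R^o, (forall m, m \in masks xs k.+1 -> J (kos xs c m)) ->
  exists b : bitseq -> R^o, forall m, m \in masks xs k -> J (c m - kos xs b m).

(** Induction on [k], passing from the quotient by the first [i] elements of [s] to
    the quotient by one more.  Contracting a cocycle [c] with the next element
    [t] of [s] gives a cochain with coboundary [t c]; modulo [t] it is a cocycle
    of lower degree, hence a coboundary, and dividing by the nonzerodivisor [t]
    exhibits [c] as a coboundary. *)
Lemma kos_exact_regular (xs s : seq R) k i :
  regular_sequence s -> [set` s] `<=` ideal_gen [set` xs] ->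
  (k + i < size s)%N -> kos_exact xs (ideal_gen [set` take i s]) k.
Proof.
move=> [_ reg] sxs; elim: k i => [|k IH] i ki c kc.
  rewrite add0n in ki; exists (fun=> 0) => m mk; rewrite kos0 // subr0.
  have /sxs/ideal_gen_dot[bs sbs E] : s`_i \in s by rewrite mem_nth.
  apply: (reg _ ki); have sm : size m = size xs by case/andP: mk => /eqP.
  rewrite E -[_ * _]/(_ *: (c m : R^o)) -kos_homotopy // kos0 // add0r.
  exact: (contract_in bs (submodule_ideal _) kc mk).
have lti : (i < size s)%N by lia.
have /sxs/ideal_gen_dot[bs sbs E] : s`_i \in s by rewrite mem_nth.
set J := ideal_gen _ in kc *; set J' := ideal_gen [set` take i.+1 s].
have JJ' x : J x -> J' x.
  by apply: ideal_gen_mono => y /=; rewrite (take_nth 0) // mem_rcons inE => ->; rewrite orbT.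
have tJ' : J' s`_i by apply: ideal_genW; rewrite /= (take_nth 0) // mem_rcons inE eqxx.
pose u := contract xs bs c.
have uc m : m \in masks xs k.+1 -> J (s`_i * c m - kos xs u m).
  move=> mk; have sm : size m = size xs by case/andP: mk => /eqP.
  rewrite E -[_ * _]/(_ *: (c m : R^o)) -kos_homotopy // addrC addKr.
  exact: (contract_in bs (submodule_ideal _) kc mk).
(* modulo s`_i the cochain u is a cocycle, with one degree and one regular
   element less *)
have [||w wP] := IH i.+1 _ u; first by lia.
  move=> m mk; rewrite -(subKr (s`_i * c m) (kos xs u m)).
  by apply: idealB; [rewrite mulrC; apply: ideal_mul|apply/JJ'/uc].
have /choice[v vP] (m : bitseq) : exists a : R, m \in masks xs k -> J (u m - kos xs w m - a * s`_i).
  have [mk|//] := boolP (m \in masks xs k); last by exists 0.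
  have [|a aP] := @ideal_gen_adjoin R [set` take i.+1 s] [set` take i s] s`_i _ _ (wP _ mk).
    by move=> g /=; rewrite (take_nth 0) // mem_rcons inE => /orP[/eqP|]; [left|right].
  by exists a.
exists v => m mk; apply: (reg _ lti).
have sJ := submodule_ideal J.
have : J (kos xs (fun m => (u m - kos xs w m) - s`_i *: (v m : R^o)) m).
  by apply: (kos_in sJ _ mk) => t /vP; rewrite mulrC.
rewrite !kosB kosZ kos_kos subr0 => H.
have := ideal_add (uc _ mk) H; congr (J _).
by rewrite addrA subrK mulrBr.
Qed.

End Koszul.

(** * A resolution bounds the vanishing of Koszul cohomology *)

Section DepthBound.
Local Open Scope ring_scope.
Local Open Scope classical_set_scope.
Variables (F : fieldType) (n : nat).
Local Notation S := {mpoly F[n]}.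
Local Notation cplx := (graded_free_complex F n).
Local Notation diff := gfc_diff.
Local Notation rk := gfc_rank.

(** An ideal is resolved as a module, with [eps] sending basis vectors to
    generators; [augment] below turns this into a resolution of the quotient ring. *)
Definition ideal_resolution (C : cplx) (eps : 'cV[S]_(rk C 0)) (I : S -> Prop) :=
  [/\ forall a, homdeg (gfc_deg a) (eps a 0),
      forall p, I p <-> exists v : 'rV_(rk C 0), p = (v *m eps) 0 0,
      forall v : 'rV_(rk C 0), v *m eps = 0 <-> exists w, v = w *m diff C 0 &
      forall i (v : 'rV_(rk C i.+1)),
        v *m diff C i = 0 <-> exists w, v = w *m diff C i.+1].

Definition variables : seq S := [seq 'X_i | i <- enum 'I_n].
Local Notation X := variables.

Lemma size_variables : size X = n.
Proof. by rewrite size_map size_enum_ord. Qed.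

Lemma variable_idealP (U : pred 'I_n) (p : S) :
  ideal_gen (fun x => exists2 i, U i & x = 'X_i) p <->
  supported (fun m => exists2 i, U i & (0 < m i)%N) p.
Proof.
have -> : (fun x => exists2 i, U i & x = 'X_i) =
    (fun k => 'X_[k]) @` (fun k => exists2 i, U i & k = U_(i)%MM) :> set S.
  rewrite predeqE => x; split; last by move=> [_ [i Ui ->] <-]; exists i.
  by move=> [i Ui ->]; exists U_(i)%MM => //; exists i.
rewrite monomial_idealP; split=> hp m /hp.
  move=> [_ [i Ui ->] /mnm_lepP/(_ i)]; rewrite mnm1E eqxx => mi; by exists i.
move=> [i Ui mi]; exists U_(i)%MM; first by exists i.
by apply/mnm_lepP=> j; rewrite mnm1E; case: eqP => [<-|].
Qed.

Lemma take_variables i :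
  [set` take i X] = (fun x => exists2 j : 'I_n, (j < i)%N & x = 'X_j).
Proof.
rewrite predeqE => x /=; rewrite -map_take; split.
  move=> /mapP[j jt ->]; exists j => //.
  have := jt; rewrite -(mem_map val_inj) map_take val_enum_ord take_iota mem_iota.
  by rewrite add0n => /leq_trans -> //; rewrite geq_minl.
move=> [j ji ->]; apply: map_f.
rewrite -(mem_map val_inj) map_take val_enum_ord take_iota mem_iota add0n.
by rewrite leq_min ji ltn_ord.
Qed.

Lemma ideal_gen_variables (p : S) : ideal_gen [set` X] p <-> p@_0%MM = 0.
Proof.
rewrite -(take_size X) size_variables take_variables variable_idealP.
split=> [hp|p0 m mp].
  by apply/memN_msupp_eq0/negP => /hp[i _]; rewrite mnm0E.
have : m != 0%MM by apply: contraL mp => /eqP ->; rewrite mcoeff_msupp p0 eqxx.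
rewrite -mdeg_eq0 mdegE sum_nat_eq0 => /forallPn[i] /=; rewrite -lt0n => mi.
by exists i.
Qed.

(** A monomial divisible by an earlier variable remains so after removal of the
    variable with index [i]. *)
Lemma variables_regular : regular_sequence X.
Proof.
split; first by rewrite ideal_gen_variables mcoeff1 eqxx => /eqP; rewrite oner_eq0.
move=> i; rewrite size_variables take_variables => ltin p.
have -> : X`_i = 'X_(Ordinal ltin).
  rewrite (nth_map (Ordinal ltin)) ?size_enum_ord //; congr 'X_(_).
  by apply: val_inj; rewrite /= nth_enum_ord.
rewrite !variable_idealP mulrC => hp m; rewrite -(msupp_mulX _ U_(Ordinal ltin)%MM).
move=> /hp[j ji]; rewrite mnmDE mnm1E; case: eqP => [ij|_ mj]; last by exists j.
by move: ji; rewrite -ij /= ltnn.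
Qed.

Local Notation masks k := (masks X k).

Lemma kos_coord r (c : bitseq -> 'rV[S]_r) j m :
  (kos X c m) 0 j = kos X (fun t => c t 0 j : S^o) m.
Proof. by elim: (X) c m => [|x xs IH] c [|[] m] /=; rewrite ?mxE ?IH. Qed.

(** The variables form a regular sequence of length [n] in [S], and the general
    case follows coordinate by coordinate. *)
Lemma kos_exact_free r k (c : bitseq -> 'rV[S]_r) : (k < n)%N ->
  (forall m, m \in masks k.+1 -> kos X c m = 0) ->
  exists b : bitseq -> 'rV[S]_r, forall m, m \in masks k -> c m = kos X b m.
Proof.
move=> kn kc.
have /choice[b bP] (j : 'I_r) : exists b : bitseq -> S^o,
    forall m, m \in masks k -> c m 0 j = kos X b m.
  have exX : kos_exact X (ideal_gen [set` take 0 X]) k.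
    apply: kos_exact_regular variables_regular _ _; last by rewrite addn0 size_variables.
    by move=> x; exact: ideal_genW.
  rewrite take0 in exX; have [m mk|b bP] := exX (fun t => c t 0 j : S^o).
    rewrite -kos_coord kc // mxE; exact: ideal_has0.
  exists b => m /bP /ideal_gen0 E; apply/eqP; rewrite -subr_eq0; apply/eqP/E.
  by move=> y /=; rewrite in_nil.
exists (fun m => \row_j b j m) => m mk; apply/rowP=> j; rewrite kos_coord bP //.
rewrite [in RHS](_ : (fun t => _) = b j) //; apply/funext=> t; by rewrite mxE.
Qed.

(** For a submodule [L], this says that the inclusion of [L] into the free module
    induces an injective map, locally at the origin, on Koszul cohomology in
    degree [k + 1]: a coboundary with values in [L] is the coboundary of an [L]-valued
    cochain, up to a denominator [s] that does not vanish at the origin. *)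
Definition locally_exact k r (L : 'rV[S]_r -> Prop) :=
  forall e : bitseq -> 'rV[S]_r, (forall m, m \in masks k.+1 -> L (kos X e m)) ->
  exists s f, [/\ s@_0%MM != 0, forall m, m \in masks k -> L (f m) &
    forall m, m \in masks k.+1 -> s *: kos X e m = kos X f m].

Lemma kos_mulmx r q (M : 'M[S]_(r, q)) (c : bitseq -> 'rV[S]_r) m :
  kos X (fun t => c t *m M) m = kos X c m *m M.
Proof.
elim: (X) c m => [|x xs IH] c [|[] m] /=; rewrite ?mul0mx //.
by rewrite mulmxBl -scalemxAl IH.
Qed.

Lemma eq_kos r (c d : bitseq -> 'rV[S]_r) k m : m \in masks k.+1 ->
  (forall t, t \in masks k -> c t = d t) -> kos X c m = kos X d m.
Proof.
move=> mk cd; apply/eqP; rewrite -subr_eq0 -kosB; apply/eqP.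
apply: (kos_in (L := fun v => v = 0) _ _ mk) => [|t /cd ->]; last exact: subrr.
by split=> // [u v -> ->|a u ->]; rewrite ?addr0 ?scaler0.
Qed.

(** Dimension shift along 0 -> ker M -> S^q -> L -> 0.  A cochain with coboundary in
    the kernel maps to a cocycle in [L], which is a coboundary in the free module
    and hence, up to a denominator, in [L]; lifting the primitive to S^q and
    subtracting its coboundary corrects the original cochain. *)
Lemma locally_exact_ker k r q (M : 'M[S]_(q, r)) (L : 'rV[S]_r -> Prop) :
  (k.+1 < n)%N -> (forall v, L v <-> exists w, v = w *m M) ->
  locally_exact k L -> locally_exact k.+1 (fun w => w *m M = 0).
Proof.
move=> kn LM exL e eM.
have [|e' e'P] := @kos_exact_free _ k.+1 (fun t => e t *m M) kn.
  by move=> m /eM; rewrite kos_mulmx.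
have [|s [f [s0 Lf sf]]] := exL e'.
  by move=> m mk; apply/LM; exists (e m); rewrite e'P.
have /choice[g gP] (m : bitseq) : exists w, m \in masks k -> f m = w *m M.
  have [/Lf/LM[w ->]|] := boolP (m \in masks k); first by exists w.
  by exists 0.
exists s, (fun t => s *: e t - kos X g t); split=> // [m mk|m mk].
  rewrite mulmxBl -scalemxAl e'P // sf // -kos_mulmx.
  by rewrite (eq_kos mk gP) subrr.
by rewrite kosB kosZ kos_kos subr0.
Qed.

Lemma mcoeff0_kos r (c : bitseq -> 'rV[S]_r) m j : ((kos X c m) 0 j)@_0%MM = 0.
Proof.
have X0 : all (fun x : S => x@_0%MM == 0) X.
  by apply/allP=> _ /mapP[i _ ->]; rewrite mcoeffX mnm1_eq0.
elim: (X) X0 c m => [|x xs IH] /= X0 c [|[] m]; rewrite ?mxE ?mcoeff0 //.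
  by case/andP: X0 => /eqP x0 X0; rewrite mcoeffB mcoeff0E x0 mul0r IH // subr0.
by case/andP: X0 => _ X0; rewrite IH.
Qed.

(** The end of the resolution: [L] is a free module, embedded by a matrix with
    entries in the ideal of the variables.  A basis vector placed on the full mask
    becomes a coboundary in the ambient module, because its image has coordinates
    in that ideal.  Were it a coboundary of an [L]-valued cochain, some [s] with
    nonzero constant term would lie in the ideal of the variables. *)
Lemma locally_exact_top r q (M : 'M[S]_(q, r)) k (L : 'rV[S]_r -> Prop) :
  k.+1 = n -> (0 < q)%N -> (forall w : 'rV_q, w *m M = 0 -> w = 0) ->
  map_mx (mcoeff 0%MM) M = 0 -> (forall v, L v <-> exists w, v = w *m M) ->
  ~ locally_exact k L.
Proof.
move=> kn q0 injM minM LM exL.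
pose g : 'rV[S]_q := delta_mx 0 (Ordinal q0).
have /choice[bs bsP] (j : 'I_r) : exists bs, size bs = size X /\ (g *m M) 0 j = dot X bs.
  have /ideal_gen_variables/ideal_gen_dot[bs sb E] : ((g *m M) 0 j)@_0%MM = 0.
    rewrite mxE raddf_sum /= big1 // => i _; rewrite mcoeff0E.
    by have /matrixP/(_ i j) := minM; rewrite !mxE => ->; rewrite mulr0.
  by exists bs.
(* contracting the constant cochain 1 yields a primitive of the j-th coordinate:
   in top degree the constant cochain is a cocycle *)
pose e m : 'rV[S]_r := \row_j contract X (bs j) (fun=> 1 : S^o) m.
have eE m : m \in masks k.+1 -> kos X e m = g *m M.
  move=> mk; apply/rowP=> j; rewrite kos_coord.
  have [sb ->] := bsP j.
  have sm : size m = size X by case/andP: mk => /eqP.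
  transitivity (dot X (bs j) *: (1 : S^o)); last by rewrite /GRing.scale /= mulr1.
  rewrite -(kos_homotopy (fun=> 1) sb sm).
  rewrite (_ : contract _ _ _ _ = 0) ?addr0.
    rewrite (_ : (fun t => e t 0 j) = contract X (bs j) (fun=> 1 : S^o)) //.
    by apply/funext=> t; rewrite mxE.
  apply: (contract_in (L := fun v => v = 0) _ _ _ mk).
    by split=> // [u v -> ->|a u ->]; rewrite ?addr0 ?scaler0.
  move=> t /andP[/eqP st /eqP ct]; move: (count_size id t).
  by rewrite ct st size_variables => le; lia.
have [|s [f [s0 Lf sf]]] := exL e.
  by move=> m /eE ->; apply/LM; exists g.
have /choice[h hP] (m : bitseq) : exists w, m \in masks k -> f m = w *m M.
  have [/Lf/LM[w ->]|] := boolP (m \in masks k); first by exists w.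
  by exists 0.
have full : nseq n true \in masks k.+1.
  by rewrite inE size_nseq size_variables kn eqxx count_nseq /= mul1n.
have := sf _ full; rewrite (eq_kos full hP) kos_mulmx eE // scalemxAl.
move/eqP; rewrite -subr_eq0 -mulmxBl => /eqP/injM/eqP; rewrite subr_eq0 => /eqP/rowP/(_ (Ordinal q0)).
move/(congr1 (mcoeff 0%MM)); rewrite mcoeff0_kos !mxE !eqxx mulr1 => /eqP.
by rewrite (negPf s0).
Qed.

(** The resolution of the quotient ring has length [q + 2], and [n - (q + 2)] is the
    degree [k] at which the depth bound of Auslander and Buchsbaum places the
    obstruction. *)
Lemma resolution_not_locally_exact (C : cplx) eps (I : S -> Prop) k q :
  ideal_resolution (C:=C) eps I -> (0 < rk C q.+1)%N -> rk C q.+2 = 0%N ->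
  map_mx (mcoeff 0%MM) (diff C q) = 0 -> (k + q).+2 = n ->
  ~ locally_exact k (fun v : 'rV_1 => I (v 0 0)).
Proof.
move=> [_ epsI exe exd] rq rq2 minq kq exI.
have ex0 : (k.+1 < n)%N -> locally_exact k.+1 (fun w => w *m eps = 0).
  move=> kn; apply: locally_exact_ker exI => // v; rewrite epsI; split=> -[w E].
    by exists w; apply/rowP=> i; rewrite ord1.
  by exists w; rewrite E.
have exS i : ((i + k).+2 < n)%N -> locally_exact (i + k).+2 (fun w => w *m diff C i = 0).
  elim: i => [|i IH] kn.
    by apply: locally_exact_ker (exe) _; [lia|apply: ex0; lia].
  by apply: locally_exact_ker (exd i) _; [lia|apply: IH; lia].
have injM (w : 'rV_(rk C q.+1)) : w *m diff C q = 0 -> w = 0.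
  move/exd => [u ->]; apply/rowP=> j; rewrite !mxE big1 // => i _.
  by have := ltn_ord i; rewrite {2}rq2.
case: q rq rq2 minq kq injM => [|q] rq rq2 minq kq injM.
  by apply: locally_exact_top (exe) _; last apply: ex0; rewrite //; lia.
by apply: locally_exact_top (exd q) (exS q _); rewrite //; lia.
Qed.

End DepthBound.

(** * Prime ideals generated by variables *)

Section VariablePrimes.
Local Open Scope ring_scope.
Local Open Scope classical_set_scope.
Variables (F : fieldType) (n : nat).
Local Notation S := {mpoly F[n]}.
Variable U : pred 'I_n.

Definition vprime (p : S) := supported (fun m => exists2 i, U i & (0 < m i)%N) p.

Let free (m : 'X_{1..n}) := [forall i, U i ==> (m i == 0%N)].

Let freeN (m : 'X_{1..n}) : (exists2 i, U i & (0 < m i)%N) <-> ~~ free m.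
Proof.
split=> [[i Ui mi]|/forallPn[i]].
  by apply/forallPn; exists i; rewrite Ui /= -lt0n.
by rewrite negb_imply -lt0n => /andP[]; exists i.
Qed.

Let vprimeE p : vprime p <-> mpart free p = 0.
Proof.
split=> [hp|p0 m mp].
  apply/mpolyP=> m; rewrite mcoeff_mpart mcoeff0; case: ifP => // fm.
  by apply/memN_msupp_eq0/negP => /hp/freeN; rewrite fm.
apply/freeN/negP => fm; move/mpolyP/(_ m): p0.
by rewrite mcoeff_mpart fm mcoeff0 => /eqP; rewrite mcoeff_eq0 mp.
Qed.

Let mpartM (p q : S) : mpart free (p * q) = mpart free p * mpart free q.
Proof.
apply/mpolyP=> m; rewrite mcoeff_mpart !mcoeffM.
have freeD (k l : 'X_{1..n}) : free (k + l)%MM = free k && free l.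
  apply/forallP/andP=> [h|[/forallP hk /forallP hl] i].
    split; apply/forallP=> i; have := h i; rewrite mnmDE addn_eq0.
      by case: (U i) => //= /andP[].
    by case: (U i) => //= /andP[].
  by have := hk i; have := hl i; rewrite mnmDE addn_eq0; case: (U i) => //= -> ->.
case: ifP => fm.
  apply: eq_bigr => -[k l] /= /eqP mkl; rewrite !mcoeff_mpart.
  by move: fm; rewrite (congr1 free mkl) freeD => /andP[-> ->].
rewrite big1 // => -[k l] /= /eqP mkl; rewrite !mcoeff_mpart.
by move: fm; rewrite (congr1 free mkl) freeD; case: (free k); case: (free l) => //= _; rewrite ?mulr0 ?mul0r.
Qed.

(** Setting the variables of [U] to zero is a ring morphism into a domain, with
    kernel [vprime]. *)
Lemma vprimeM p q : vprime (p * q) -> vprime p \/ vprime q.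
Proof.
rewrite !vprimeE mpartM => /eqP; rewrite mulf_eq0.
by case/orP=> /eqP; [left|right].
Qed.

Lemma vprime0 : vprime 0. Proof. exact: supported0. Qed.
Lemma vprimeD p q : vprime p -> vprime q -> vprime (p + q).
Proof. exact: supportedD. Qed.
Lemma vprime_mul a p : vprime p -> vprime (a * p).
Proof.
apply: supportedM => m k [i Ui mi]; exists i => //.
by rewrite mnmDE; lia.
Qed.

Lemma vprime_coeff0 p : vprime p -> p@_0%MM = 0.
Proof. by move=> hp; apply/memN_msupp_eq0/negP => /hp[i _]; rewrite mnm0E. Qed.

Lemma vprimeX i : vprime 'X_i <-> U i.
Proof.
split=> [/(_ U_(i)%MM)|Ui m].
  rewrite msuppX inE eqxx => /(_ isT)[j Uj]; rewrite mnm1E.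
  by case: eqP => // ->.
by rewrite msuppX inE => /eqP ->; exists i; rewrite ?mnm1E ?eqxx.
Qed.

End VariablePrimes.

(** * The local ring at the origin *)

Section Localization.
Local Open Scope ring_scope.
Local Open Scope classical_set_scope.
Variables (F : fieldType) (n : nat).
Local Notation S := {mpoly F[n]}.
Local Notation X := (variables F n).
Variables (I : ideal S) (B : comPzRingType) (g : {rmorphism S -> B}).

(** Together, these say that [g] exhibits [B] as the localization of [S / I] at
    the ideal of the origin. *)
Hypothesis g_unit : forall s, s@_0%MM != 0 -> exists t, g s * t = 1.
Hypothesis g_frac : forall b, exists p s, s@_0%MM != 0 /\ b * g s = g p.
Hypothesis g_ker : forall p, g p = 0 -> exists s, s@_0%MM != 0 /\ I (s * p).
Hypothesis g_I : forall p, I p -> g p = 0.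

Lemma one_coeff0 : (1 : S)@_0%MM != 0.
Proof. by rewrite mcoeff1 eqxx oner_eq0. Qed.

Section PrimeExtension.
Variable U : pred 'I_n.
Hypothesis I_U : forall p, I p -> vprime U p.

Let ext (b : B) := exists p s, [/\ s@_0%MM != 0, vprime U p & b * g s = g p].

Let ext_rep b p s : s@_0%MM != 0 -> b * g s = g p -> ext b -> vprime U p.
Proof.
move=> s0 bs [p' [s' [s'0 Up' bs']]].
have : g (s' * p - s * p') = 0.
  rewrite rmorphB !rmorphM /= -bs -bs'; ring.
move/g_ker => [t [t0 /I_U /vprimeM[/vprime_coeff0 t00|]]].
  by rewrite t00 eqxx in t0.
move=> Ud; have : vprime U (s' * p).
  by rewrite -(subrK (s * p') (s' * p)); apply: vprimeD => //; apply: vprime_mul.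
case/vprimeM => // /vprime_coeff0 s00; by rewrite s00 eqxx in s'0.
Qed.

Let ext0 : ext 0.
Proof. by exists 0, 1; split; [exact: one_coeff0|exact: vprime0|rewrite mul0r rmorph0]. Qed.

Let extD b c : ext b -> ext c -> ext (b + c).
Proof.
move=> [p [s [s0 Up bs]]] [q [t [t0 Uq ct]]]; exists (t * p + s * q), (s * t); split.
- by rewrite mcoeff0E mulf_neq0.
- by apply: vprimeD; apply: vprime_mul.
- rewrite rmorphD !rmorphM /= -bs -ct; ring.
Qed.

Let extM a b : ext b -> ext (a * b).
Proof.
move=> [p [s [s0 Up bs]]]; have [q [t [t0 at_]]] := g_frac a.
exists (q * p), (t * s); split; first by rewrite mcoeff0E mulf_neq0.
  exact: vprime_mul.
rewrite !rmorphM /= -bs -at_; ring.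
Qed.

Definition extension : ideal B := Ideal ext0 extD extM.

(** Membership in the extended ideal may be tested on any fraction representing the
    element, since denominators are not in the prime. *)
Lemma extension_rep b p s : s@_0%MM != 0 -> b * g s = g p -> extension b <-> vprime U p.
Proof. by move=> s0 bs; split=> [|Up]; [exact: (ext_rep s0 bs)|exists p, s]. Qed.

Lemma extension_prime : prime_ideal extension.
Proof.
split.
  rewrite (@extension_rep _ 1 1) ?one_coeff0 ?mul1r // => /vprime_coeff0 /eqP.
  by rewrite (negPf one_coeff0).
move=> b c; have [p [s [s0 bs]]] := g_frac b; have [q [t [t0 ct]]] := g_frac c.
rewrite (extension_rep s0 bs) (extension_rep t0 ct) (@extension_rep _ (p * q) (s * t)).
- exact: vprimeM.
- by rewrite mcoeff0E mulf_neq0.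
- by rewrite !rmorphM /= -bs -ct; ring.
Qed.

Lemma extensionX i : extension (g 'X_i) <-> U i.
Proof. by rewrite (@extension_rep _ 'X_i 1) ?one_coeff0 ?rmorph1 ?mulr1 ?vprimeX. Qed.

End PrimeExtension.

(** Start from the prime generated by the two given variables and adjoin the other
    variables one at a time, in the order of the list [l]. *)
Lemma prime_chain_ex (i j : 'I_n) : i != j ->
  (forall p, I p -> vprime (pred2 i j) p) ->
  exists P : nat -> ideal B, prime_chain n.-2 P.
Proof.
move=> ij Iij.
pose l := [:: i, j & [seq v <- enum 'I_n | (v != i) && (v != j)]].
have ul : uniq l.
  rewrite /= !inE !mem_filter !eqxx /= andbF orbF filter_uniq ?enum_uniq //.
  by rewrite ij.
have sl : size l = n.
  rewrite -[RHS](size_enum_ord n); apply: perm_size; apply: uniq_perm => //.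
    exact: enum_uniq.
  move=> v; rewrite mem_enum !inE mem_filter mem_enum.
  by case: eqVneq => // _; case: eqVneq.
pose U k : pred 'I_n := fun v => v \in take k.+2 l.
have IU k p : I p -> vprime (U k) p.
  move=> /Iij hp m /hp[v /orP[/eqP ->|/eqP ->] mv].
    by exists i => //; rewrite /U /= inE eqxx.
  by exists j => //; rewrite /U /= !inE eqxx orbT.
exists (fun k => extension (U k)); split=> k kn; first exact: (extension_prime (IU k)).
have kl : (k.+2 < size l)%N by rewrite sl; lia.
split.
  move=> b [p [s [s0 Up bs]]]; exists p, s; split=> // m /Up[v Uv mv].
  by exists v => //; rewrite /U (take_nth i) // mem_rcons inE; apply/orP; right.
move=> /(_ (g 'X_(nth i l k.+2))) /=.
have: extension (U k.+1) (g 'X_(nth i l k.+2)).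
  by rewrite (extensionX (IU k.+1)) /U (take_nth i) // mem_rcons inE eqxx.
move=> h /(_ h) /(extensionX (IU k)); rewrite /U => ink.
have := ul; rewrite -(cat_take_drop k.+2 l) cat_uniq (drop_nth i) // => /and3P[_ /hasPn/(_ (nth i l k.+2))].
by rewrite inE eqxx => /(_ isT) /negP.
Qed.

Lemma maximal_ideal_variables (N : ideal B) : ~ N 1 -> N `<=` ideal_gen [set` map g X].
Proof.
move=> N1 b Nb; have [p [s [s0 bs]]] := g_frac b.
have [t st] := g_unit s0.
have p0 : p@_0%MM = 0.
  apply/eqP/contraT => /g_unit[u pu]; case: N1; rewrite -pu -bs -mulrA mulrC.
  exact: ideal_mul.
have -> : b = t * g p by rewrite -bs mulrC -mulrA st mulr1.
apply: ideal_mul; move/ideal_gen_variables: p0.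
pose J0 (p : S) := ideal_gen [set` map g X] (g p).
have J00 : J0 0 by rewrite /J0 rmorph0; exact: ideal_has0.
have J0D u v : J0 u -> J0 v -> J0 (u + v) by rewrite /J0 rmorphD; exact: ideal_add.
have J0M a u : J0 u -> J0 (a * u) by rewrite /J0 rmorphM; exact: ideal_mul.
apply: (ideal_gen_le (I := Ideal J00 J0D J0M)) => x xX.
by apply: ideal_genW; rewrite /=; exact: map_f.
Qed.

Lemma masks_map xs k m : (m \in masks (map g xs) k) = (m \in masks xs k).
Proof. by rewrite /masks !inE /= size_map. Qed.

Lemma kos_rmorph xs (c : bitseq -> S^o) m :
  g (kos xs c m) = kos (map g xs) (fun t => g (c t) : B^o) m.
Proof.
elim: xs c m => [|x xs IH] c [|[] m] /=; rewrite ?rmorph0 ?IH //.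
by rewrite rmorphB rmorphM IH.
Qed.

(** Masks of size [n] are finite in number, so that denominators indexed by masks
    can be cleared all at once. *)
Lemma common_multiple (a : bitseq -> S) : (forall m, (a m)@_0%MM != 0) ->
  exists s r, s@_0%MM != 0 /\ forall m, size m = n -> s = r m * a m.
Proof.
move=> a0; exists (\prod_(t : n.-tuple bool) a t).
exists (fun m => \prod_(t : n.-tuple bool | val t != m) a t); split.
  by rewrite (rmorph_prod (mcoeff 0%MM)); apply/prodf_neq0 => t _; exact: a0.
move=> m sm; have sm' : size m == n by rewrite sm.
by rewrite (bigD1 (Tuple sm')) //= mulrC.
Qed.

(** The vanishing given by a regular sequence holds over the local ring [B].  It is
    brought back to [S] by clearing two families of denominators: those of the
    primitive found in [B], then those witnessing that an equation in [B] comes from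
    one modulo [I]. *)
Lemma locally_exact_localization k (s : seq B) :
  regular_sequence s -> [set` s] `<=` ideal_gen [set` map g X] -> (k < size s)%N ->
  locally_exact k (fun v : 'rV[S]_1 => I (v 0 0)).
Proof.
move=> reg sX ks e eI.
have exB : kos_exact (map g X) (ideal_gen [set` take 0 s]) k.
  by apply: kos_exact_regular sX _; rewrite ?addn0.
have [|b bP] := exB (fun m => g (e m 0 0)).
  move=> m mk; suff -> : kos (map g X) (fun t => g (e t 0 0) : B^o) m = 0 by exact: ideal_has0.
  rewrite -(kos_rmorph X (fun t => e t 0 0)); apply: g_I.
  have mk' : m \in masks X k.+1 by rewrite ?masks_map // -masks_map.
  have := eI _ mk'; congr (I _).
  elim: (X) e m {eI mk mk'} => [|x xs IH] e [|[] m] /=; rewrite ?mxE ?IH //.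
have {}bP m : m \in masks X k -> g (e m 0 0) = kos (map g X) b m.
  move=> mk; have mk' : m \in masks (map g X) k by rewrite ?masks_map // -masks_map.
  apply/eqP; rewrite -subr_eq0; apply/eqP.
  by apply: ideal_gen0 (bP _ mk') => y /=; rewrite take0 in_nil.
have /choice[ps psP] (m : bitseq) := g_frac (b m).
have /choice[d dP] := psP.
(* a common denominator s1 of the values of b, with numerators b' *)
have [s1 [r1 [s10 r1P]]] := common_multiple (fun m => (dP m).1).
pose b' m : S^o := ps m * r1 m.
have gb' m : size m = n -> g (b' m) = g s1 * b m.
  by move=> sm; rewrite (r1P _ sm) !rmorphM /= -(dP m).2; ring.
have kerP m : m \in masks X k -> g (s1 * e m 0 0 - kos X b' m) = 0.
  move=> mk; rewrite rmorphB rmorphM bP //= kos_rmorph.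
  have E : kos (map g X) (fun t => g (b' t) : B^o) m = kos (map g X) (fun t => g s1 *: (b t : B^o)) m.
    case: k mk {ks eI bP exB} => [|k] mk.
      by rewrite !kos0 ?masks_map.
    apply/eqP; rewrite -subr_eq0 -kosB; apply/eqP.
    have mk' : m \in masks (map g X) k.+1 by rewrite ?masks_map // -masks_map.
    apply: (kos_in (L := fun v => v = 0) _ _ mk').
      by split=> // [u v -> ->|a u ->]; rewrite ?addr0 ?scaler0.
    move=> t /andP[/eqP st _]; rewrite gb' ?subrr //.
    by rewrite st size_map size_variables.
  by rewrite E kosZ subrr.
have /choice[a aP] (m : bitseq) : exists a : S, a@_0%MM != 0 /\
    (m \in masks X k -> I (a * (s1 * e m 0 0 - kos X b' m))).
  have [/kerP/g_ker[a [a0 Ia]]|_] := boolP (m \in masks X k); first by exists a.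
  by exists 1; split=> //; exact: one_coeff0.
(* s2 moves all the resulting equations from B back to S modulo I *)
have [s2 [r2 [s20 r2P]]] := common_multiple (fun m => (aP m).1).
pose b2 m : 'rV[S]_1 := \row__ (s2 * b' m).
exists (s2 * s1), (fun m => (s2 * s1) *: e m - kos X b2 m); split.
- by rewrite mcoeff0E mulf_neq0.
- move=> m mk; have sm : size m = n by case/andP: mk => /eqP ->; rewrite size_variables.
  rewrite !mxE.
  have -> : kos X b2 m 0 0 = s2 * kos X b' m.
    rewrite -[RHS]/(s2 *: (kos X b' m : S^o)) -kosZ /b2.
    elim: (X) (b') m {mk sm} => [|x xs IH] c [|[] m] /=; rewrite ?mxE ?IH //.
  rewrite -mulrA -mulrBr (r2P _ sm) -mulrA; apply: ideal_mul; exact: (aP m).2.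
- by move=> m mk; rewrite kosB kosZ kos_kos subr0.
Qed.

End Localization.

(** * A criterion for not being Cohen-Macaulay *)

Section NotCohenMacaulay.
Local Open Scope ring_scope.
Local Open Scope classical_set_scope.
Variables (F : fieldType) (n : nat).
Local Notation S := {mpoly F[n]}.

Section Origin.
Variable I : ideal S.
Hypothesis I0 : forall p, I p -> p@_0%MM = 0.
Local Notation A := (quotient_ring I).

Let origin_set (a : A) := exists2 p : S, a = quotient_proj I p & p@_0%MM = 0.

Let originP p : origin_set (quotient_proj I p) <-> p@_0%MM = 0.
Proof.
split=> [[q /quotient_proj_eq/I0 E q0]|]; last by exists p.
by apply/eqP; rewrite -(subrK q p) mcoeffD E q0 addr0.
Qed.

Let origin0 : origin_set 0.
Proof. by exists 0; rewrite ?rmorph0 ?mcoeff0. Qed.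
Let originD a b : origin_set a -> origin_set b -> origin_set (a + b).
Proof.
move=> [p -> p0] [q -> q0]; exists (p + q); first by rewrite quotient_projD.
by rewrite mcoeffD p0 q0 addr0.
Qed.
Let originM a b : origin_set b -> origin_set (a * b).
Proof.
elim/quotient_proj_ind: a => a [p -> p0]; exists (a * p); first by rewrite rmorphM.
by rewrite mcoeff0E p0 mulr0.
Qed.

Definition origin : ideal A := Ideal origin0 originD originM.

Lemma origin_proj p : origin (quotient_proj I p) <-> p@_0%MM = 0.
Proof. exact: originP. Qed.

Lemma origin_maximal : maximal_ideal origin.
Proof.
split.
  rewrite -(rmorph1 (quotient_proj I)) origin_proj mcoeff1 eqxx => /eqP.
  by rewrite oner_eq0.
move=> J MJ J1; elim/quotient_proj_ind=> p Jp; apply/origin_proj.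
apply/eqP/contraT => p0; case: J1.
pose c := p@_0%MM.
have Jc : J (quotient_proj I c%:MP).
  have -> : c%:MP = p - (p - c%:MP) by rewrite opprB addrC subrK.
  rewrite rmorphB; apply: idealB => //; apply: MJ; apply/origin_proj.
  by rewrite mcoeffB mcoeffC eqxx mulr1 subrr.
rewrite -(rmorph1 (quotient_proj I)).
have -> : 1 = c^-1%:MP * c%:MP :> S by rewrite -mpolyCM mulVf // mpolyC1.
by rewrite rmorphM; apply: ideal_mul.
Qed.

End Origin.

(** The depth at the origin is at most [n - (q + 3)], since the resolution of the
    quotient has length [q + 3], while the dimension there is at least [n - 2]. *)
Theorem not_cohen_macaulay (I : ideal S) (C : graded_free_complex F n) eps (i j : 'I_n) q :
  ideal_resolution (C:=C) eps I ->
  (0 < gfc_rank C q.+2)%N -> gfc_rank C q.+3 = 0%N ->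
  map_mx (mcoeff 0%MM) (gfc_diff C q.+1) = 0 -> (q.+3 <= n)%N ->
  i != j -> (forall p, I p -> vprime (pred2 i j) p) ->
  ~ cohen_macaulay (quotient_ring I).
Proof.
move=> res rq rq1 minq qn ij Iij cm.
have I0 p : I p -> p@_0%MM = 0 by move/Iij/vprime_coeff0.
have [B [f [[funit ffrac fker] [N [[[N1 _] _] [d [[_ dimd] [[s [sd sN sreg]] _]]]]]]]] :=
  cm _ (origin_maximal I0).
pose g : {rmorphism S -> B} := f \o quotient_proj I.
have g_unit u : u@_0%MM != 0 -> exists t, g u * t = 1.
  by move=> u0; apply: funit => /(origin_proj I0) E; case/eqP: u0.
have nz t : ~ origin I (quotient_proj I t) -> t@_0%MM != 0.
  by move=> nt; apply/eqP => t0; apply/nt/(origin_proj I0).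
have g_frac b : exists p s, s@_0%MM != 0 /\ b * g s = g p.
  have [a [t]] := ffrac b; elim/quotient_proj_ind: a => p; elim/quotient_proj_ind: t => t.
  by move=> [/nz t0 E]; exists p, t.
have g_ker p : g p = 0 -> exists s, s@_0%MM != 0 /\ I (s * p).
  move=> /fker[t]; elim/quotient_proj_ind: t => t [/nz t0 E].
  by exists t; split=> //; apply/proj0P; rewrite rmorphM.
have g_I p : I p -> g p = 0 by move=> /proj0P; rewrite /g /= => ->; rewrite rmorph0.
have [P /dimd nd] := prime_chain_ex g_frac g_ker ij Iij.
apply: (resolution_not_locally_exact (k := n - q.+3) res rq rq1 minq); first by lia.
apply: (locally_exact_localization g_frac g_ker g_I sreg); last by rewrite sd; lia.
by move=> x /sN; exact: (maximal_ideal_variables g_unit g_frac N1).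
Qed.

End NotCohenMacaulay.

(** * Pure resolutions and products with an ideal of two variables *)

Section PureResolutions.
Local Open Scope ring_scope.
Variables (F : fieldType) (n : nat).
Local Notation S := {mpoly F[n]}.
Local Notation cplx := (graded_free_complex F n).
Local Notation diff := gfc_diff.
Local Notation rk := gfc_rank.

Section Augment.
Variables (C : cplx) (eps : 'cV[S]_(rk C 0)).
Hypothesis eps_hom : forall a, homdeg (gfc_deg a) (eps a 0).

Definition augment_rank i := if i is i'.+1 then rk C i' else 1%N.

Definition augment_deg i : 'I_(augment_rank i) -> int :=
  match i with 0 => fun=> 0 | i'.+1 => gfc_deg (i:=i') end.

Definition augment_diff i : 'M[S]_(augment_rank i.+1, augment_rank i) :=
  match i with 0 => eps | i'.+1 => diff C i' end.

Fact augment_homog i a b m : m \in msupp (augment_diff i a b) ->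
  (mdeg m)%:Z + augment_deg b = augment_deg a.
Proof.
case: i a b => [|i] a b; last exact: gfc_homog.
by rewrite [b]ord1 => /eps_hom; rewrite addr0.
Qed.

Definition augment : cplx := GradedFreeComplex augment_homog.

Lemma augment_resolves (I : ideal S) : ideal_resolution eps I -> resolves augment I.
Proof.
move=> [_ epsI exe exd]; exists (1%:M : 'M_1); split.
- move=> a m; rewrite [a]ord1 mxE eqxx msupp1 inE => /eqP ->.
  by rewrite mdeg0.
- move=> q; exists (repr (q : Quotient.quot (ideal_pred I)))%:M.
  by rewrite mulmx1 mxE eqxx quotient_projK.
- move=> v; rewrite mulmx1 proj0P epsI; split=> -[w E]; exists w.
    by apply/rowP=> i; rewrite ord1 E.
  by rewrite E.
- by case=> [|i] v /=; [exact: exe|exact: exd].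
Qed.

End Augment.

Definition pure (C : cplx) (d : nat -> int) :=
  forall i (a : 'I_(rk C i)), gfc_deg a = d i.

(** A nonzero constant entry would relate generators of equal degree. *)
Lemma pure_minimal C d i : pure C d -> d i.+1 != d i -> tensor_diff C i = 0.
Proof.
move=> pC di; apply/matrixP=> a b; rewrite !mxE; apply/memN_msupp_eq0/negP.
by move=> /gfc_homog; rewrite mdeg0 !pC add0r => E; rewrite E eqxx in di.
Qed.

Lemma tor_dim_pure C d i j : pure C d -> (forall i, d i.+1 != d i) ->
  tor_dim C i j = if d i == j then rk C i else 0%N.
Proof.
move=> pC dd; have tdeg k : tensor_deg C k j = (d k == j)%:R%:M.
  rewrite /tensor_deg -diag_const_mx; congr diag_mx.
  by apply/rowP=> a; rewrite !mxE pC.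
have tdiff k : tensor_diff C k = 0 by apply: pure_minimal pC _.
have rkM k : \rank (tensor_deg C k j) = if d k == j then rk C k else 0%N.
  by rewrite tdeg; case: eqP => _; rewrite ?mxrank1 // (_ : 0%:M = 0) ?mxrank0 // raddf0.
rewrite /tor_dim /tensor_boundaries tdiff mulmx0 mxrank0 subn0 -rkM.
case: i => [//|i] /=; rewrite tdiff; apply/eqP; rewrite eqn_leq.
by rewrite !mxrankS ?capmxSl // sub_capmx submx_refl sub_kermx mulmx0 eqxx.
Qed.

Lemma resolution_generated (C : cplx) eps (I : ideal S) (s : nat) :
  ideal_resolution (C:=C) eps I -> (forall a : 'I_(rk C 0), gfc_deg a = s%:Z) ->
  generated_in_degree s I.
Proof.
move=> [epsh epsI _ _] ds.
exists (fun g => exists a, g = eps a 0); split.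
  by move=> _ [a ->]; apply/dhomogP => m /epsh; rewrite ds => -[].
rewrite predeqE => p; split.
  move/epsI => [v ->]; rewrite mxE.
  elim/big_ind: _ => [|u w|a _]; [exact: ideal_has0|exact: ideal_add|].
  by apply: ideal_mul; apply: ideal_genW; exists a.
apply: (ideal_gen_le (I := I)) => _ [a ->]; apply/epsI.
by exists (delta_mx 0 a); rewrite -rowE mxE.
Qed.

Section Product.
Variables (C : cplx) (eps : 'cV[S]_(rk C 0)) (x y : S).
Hypotheses (x1 : homdeg 1 x) (y1 : homdeg 1 y).
Hypothesis eps_hom : forall a, homdeg (gfc_deg a) (eps a 0).

Definition shift_rank i := if i is i'.+1 then rk C i' else 0%N.

Definition shift_deg i : 'I_(shift_rank i) -> int :=
  match i with 0 => fun=> 0 | i'.+1 => gfc_deg (i:=i') end.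

Definition shift_diff i : 'M[S]_(shift_rank i.+1, shift_rank i) :=
  match i with 0 => 0 | i'.+1 => diff C i' end.

Definition prod_rank i := (rk C i + rk C i + shift_rank i)%N.

Definition prod_deg i (a : 'I_(prod_rank i)) : int :=
  match split a with
  | inl b => match split b with inl c | inr c => gfc_deg c + 1 end
  | inr c => shift_deg c + 2
  end.

Definition prod_diff i : 'M[S]_(prod_rank i.+1, prod_rank i) :=
  block_mx (block_mx (diff C i) 0 0 (diff C i)) 0
           (row_mx y%:M (- x%:M)) (- shift_diff i).

Definition prod_eps : 'cV[S]_(prod_rank 0) :=
  col_mx (col_mx (x *: eps) (y *: eps)) 0.

Fact prod_homog i a b m : m \in msupp (prod_diff i a b) ->
  (mdeg m)%:Z + prod_deg b = prod_deg a.
Proof.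
have hs (c e : 'I_(rk C i)) (z : S) k : homdeg 1 z ->
    k \in msupp (z%:M c e) -> (mdeg k)%:Z + (gfc_deg e + 1) = gfc_deg c + 2.
  move=> hz; rewrite mxE; case: eqP => [->|_]; last by rewrite msupp0.
  by move/hz => ->; ring.
rewrite /prod_deg /prod_diff; case: (split_ordP a) => [a' ->|a' ->];
  case: (split_ordP b) => [b' ->|b' ->].
- rewrite block_mxEul; case: (split_ordP a') => [c ->|c ->];
  case: (split_ordP b') => [e ->|e ->].
  + by rewrite block_mxEul => /gfc_homog <-; rewrite addrA.
  + by rewrite block_mxEur mxE msupp0.
  + by rewrite block_mxEdl mxE msupp0.
  + by rewrite block_mxEdr => /gfc_homog <-; rewrite addrA.
- by rewrite block_mxEur mxE msupp0.
- rewrite block_mxEdl; case: (split_ordP b') => [e ->|e ->].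
    by rewrite row_mxEl; exact: hs.
  by rewrite row_mxEr mxE (perm_mem (msuppN _)); exact: hs.
- rewrite block_mxEdr mxE (perm_mem (msuppN _)).
  case: i {hs a b} a' b' => [|i] a' b' /=; first by case: b'.
  by move/gfc_homog => <-; rewrite addrA.
Qed.

(** The tensor product of [C] with the resolution of the ideal (x, y), which has the
    two generators [x], [y] and the single relation (y, -x).  Its module in
    homological degree [i] consists of two copies of the [i]-th module of [C] and a
    copy of the previous one. *)
Definition prod_complex : cplx := GradedFreeComplex prod_homog.

Lemma prod_diffE i (u v : 'rV_(rk C i.+1)) (w : 'rV_(rk C i)) :
  row_mx (row_mx u v) (w : 'rV_(shift_rank i.+1)) *m prod_diff i =
  row_mx (row_mx (u *m diff C i + y *: w) (v *m diff C i - x *: w))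
         (- ((w : 'rV_(shift_rank i.+1)) *m shift_diff i)).
Proof.
rewrite /prod_diff mul_row_block mul_row_block mul_mx_row !mulmx0 !add0r addr0.
by rewrite mulmxN mulmxN !mul_mx_scalar add_row_mx.
Qed.

Lemma prod_epsE (u v : 'rV_(rk C 0)) (w : 'rV_0) :
  row_mx (row_mx u v) w *m prod_eps = x *: (u *m eps) + y *: (v *m eps).
Proof. by rewrite !mul_row_col mulmx0 addr0 -!scalemxAr. Qed.

(** In positive degrees exactness comes from that of [C]: the third component [w] of
    a cycle is a cycle, in the lowest degree because [y] is a nonzerodivisor, and
    once it is removed the two other components are cycles of [C].  In degree zero the
    hypothesis on [I] says that the only relations between [x] and [y] with
    coefficients in [I] are the multiples of (y, -x) by elements of [I]. *)
Lemma prod_resolution (I J : S -> Prop) :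
  y != 0 ->
  (forall p, J p <-> exists a b, [/\ I a, I b & p = x * a + y * b]) ->
  (forall a b, I a -> I b -> x * a + y * b = 0 ->
     exists c, [/\ I c, a = y * c & b = - (x * c)]) ->
  ideal_resolution eps I -> ideal_resolution (C := prod_complex) prod_eps J.
Proof.
move=> y0 JI reg [_ epsI exe exd].
have dd i : diff C i.+1 *m diff C i = 0.
  by apply/row_matrixP=> a; rewrite row0 rowE mulmxA; apply/exd; exists (delta_mx 0 a).
have de : diff C 0 *m eps = 0.
  by apply/row_matrixP=> a; rewrite row0 rowE mulmxA; apply/exe; exists (delta_mx 0 a).
have row3 i (v : 'rV[S]_(prod_rank i)) : exists u1 u2 w, v = row_mx (row_mx u1 u2) w.
  by exists (lsubmx (lsubmx v)), (rsubmx (lsubmx v)), (rsubmx v); rewrite !hsubmxK.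
have cancel z r (v : 'rV[S]_r) : z != 0 -> z *: v = 0 -> v = 0.
  move=> z0 /rowP zv; apply/rowP=> j; have := zv j; rewrite !mxE => /eqP.
  by rewrite mulf_eq0 (negPf z0) => /eqP.
split.
- move=> a m; rewrite /= /prod_deg /prod_eps.
  have he z (b : 'I_(rk C 0)) k : homdeg 1 z -> k \in msupp ((z *: eps) b 0) ->
      (mdeg k)%:Z = gfc_deg b + 1.
    by move=> hz; rewrite mxE [_ + 1]addrC => km; have H := homdegM hz (@eps_hom b); exact: (H _ km).
  case: (split_ordP a) => [a' ->|[]//]; rewrite col_mxEu.
  by case: (split_ordP a') => [c ->|c ->]; rewrite (col_mxEu, col_mxEd); apply: he.
- move=> p; rewrite JI; split=> [[a [b [/epsI[u ->] /epsI[v ->] ->]]]|[v ->]].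
    by exists (row_mx (row_mx u v) (0 : 'rV_0)); rewrite prod_epsE !mxE.
  have [u1 [u2 [w ->]]] := row3 0%N v.
  exists ((u1 *m eps) 0 0), ((u2 *m eps) 0 0); split; try by apply/epsI; eexists.
  by rewrite prod_epsE !mxE.
- move=> v; have [u1 [u2 [w ->]]] := row3 0%N v; split=> [|[t ->]].
    move/rowP/(_ 0); rewrite prod_epsE !mxE => E.
    have [||c [/epsI[t ->] E1 E2]] := reg _ _ _ _ E.
    + by apply/epsI; exists u1; rewrite mxE.
    + by apply/epsI; exists u2; rewrite mxE.
    have /exe[s1 s1E] : (u1 - y *: t) *m eps = 0.
      apply/rowP=> i; rewrite ord1 mulmxBl -scalemxAl !mxE E1 -/(mulmx _ _ _ _) mxE.
      exact: subrr.
    have /exe[s2 s2E] : (u2 + x *: t) *m eps = 0.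
      by apply/rowP=> i; rewrite ord1 mulmxDl -scalemxAl !mxE E2 mxE addNr.
    exists (row_mx (row_mx s1 s2) t); rewrite prod_diffE.
    rewrite -s1E -s2E subrK addrK; congr row_mx.
    by apply/rowP=> -[].
  have [s1 [s2 [r ->]]] := row3 1%N t; rewrite prod_diffE prod_epsE.
  rewrite !mulmxDl -!mulmxA de !mulmx0 !add0r mulNmx -!scalemxAl.
  by rewrite !scalerN !scalerA mulrC subrr.
- move=> i v; have [u1 [u2 [w ->]]] := row3 i.+1 v; split=> [|[t ->]].
    move=> /= E; have := E; rewrite prod_diffE => {}E.
    have [E12 E3] := eq_row_mx (etrans E (esym (row_mx0 _ _ _ _))).
    have [E1 E2] := eq_row_mx (etrans E12 (esym (row_mx0 _ _ _ _))).
    have [w' ww'] : exists w' : 'rV_(rk C i.+1), w = w' *m diff C i.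
      case: i u1 u2 w E3 E1 E2 {E12 E v} => [|i] u1 u2 w E3 E1 E2.
        apply/exe/(cancel y) => //; move/(congr1 (mulmx^~ eps)): E1.
        by rewrite mulmxDl -mulmxA de mulmx0 add0r mul0mx -scalemxAl.
      by apply/exd/eqP; rewrite -oppr_eq0; apply/eqP.
    (* adding the differential of (0, 0, w') removes the third component *)
    have /exd[s1 s1E] : (u1 + y *: w') *m diff C i = 0.
      by rewrite mulmxDl -scalemxAl -ww'.
    have /exd[s2 s2E] : (u2 - x *: w') *m diff C i = 0.
      by rewrite mulmxBl -scalemxAl -ww'.
    exists (row_mx (row_mx s1 s2) (- w')); rewrite prod_diffE.
    rewrite -s1E -s2E !scalerN addrK opprK subrK; congr row_mx.
    by rewrite mulNmx opprK.
  have [s1 [s2 [r ->]]] := row3 i.+2 t; rewrite /= prod_diffE prod_diffE.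
  rewrite mulmxDl mulmxBl -!mulmxA dd !mulmx0 add0r sub0r -!scalemxAl scalerN subrr.
  rewrite scalerN opprK addNr mulNmx opprK -mulmxA (_ : _ *m shift_diff i = 0).
    by rewrite mulmx0 !row_mx0.
  by case: i {v u1 u2 w t s1 s2 r} => [|i]; [exact: mulmx0|exact: dd].
Qed.

Lemma prod_pure (d : int) : pure C (fun i => d + i%:Z) ->
  pure prod_complex (fun i => d + 1 + i%:Z).
Proof.
move=> pC i a; rewrite /= /prod_deg; case: split => [b|c].
  by case: split => c; rewrite pC; ring.
case: i a c => [|i] a c /=; first by case: c.
by rewrite pC intS; ring.
Qed.

End Product.

End PureResolutions.

(** * Products of ideals of disjoint pairs of variables *)

Section PairCovers.
Local Open Scope ring_scope.
Variables (F : fieldType) (n : nat).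
Local Notation S := {mpoly F[n]}.
Local Notation mnm := 'X_{1..n}.

Lemma supported_split (P : pred mnm) (Q : mnm -> Prop) (p : S) :
  supported Q p -> exists p1 p2, [/\ p = p1 + p2,
    supported (fun m => P m /\ Q m) p1 & supported (fun m => ~~ P m /\ Q m) p2].
Proof.
move=> hp; have sup (P' : pred mnm) : supported (fun m => P' m /\ Q m) (mpart P' p).
  move=> m; rewrite mcoeff_msupp mcoeff_mpart; case: ifP => [Pm|_]; last by rewrite eqxx.
  by rewrite -mcoeff_msupp => /hp.
exists (mpart P p), (mpart (predC P) p).
by split; [rewrite [LHS]mpolyE (bigID P)|exact: sup|exact: (sup (predC P))].
Qed.

(** The monomials divisible by a variable of each pair, i.e. those in the product
    of the ideals of the pairs when the pairs are disjoint. *)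
Definition covers (l : seq ('I_n * 'I_n)) (m : mnm) :=
  all (fun xy => (0 < m xy.1)%N || (0 < m xy.2)%N) l.

Section Step.
Variables (x y : 'I_n) (l : seq ('I_n * 'I_n)).
Hypothesis xy : x != y.
Hypothesis xl : forall e, e \in l -> [/\ x != e.1, x != e.2, y != e.1 & y != e.2].

Lemma coversDx m : covers l (U_(x) + m)%MM = covers l m.
Proof.
apply: eq_in_all => e /xl[x1 x2 _ _].
by rewrite !mnmDE !mnm1E (negPf x1) (negPf x2).
Qed.

Lemma coversDy m : covers l (U_(y) + m)%MM = covers l m.
Proof.
apply: eq_in_all => e /xl[_ _ y1 y2].
by rewrite !mnmDE !mnm1E (negPf y1) (negPf y2).
Qed.

Lemma covers_cons (p : S) :
  supported (covers ((x, y) :: l)) p <->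
  exists a b, [/\ supported (covers l) a, supported (covers l) b &
                  p = 'X_x * a + 'X_y * b].
Proof.
have lt0 k (m : mnm) : (0 < m k)%N -> (U_(k) <= m)%MM.
  by move=> mk; apply/mnm_lepP=> j; rewrite mnm1E; case: eqP => [<-|].
split.
  move=> /(supported_split (fun m => (0 < m x)%N))[p1 [p2 [-> h1 h2]]].
  have [a aE] : exists a, p1 = a * 'X_x.
    by apply: supported_divX => m /h1[/lt0].
  have [b bE] : exists b, p2 = b * 'X_y.
    apply: supported_divX => m /h2[mx /andP[/=]].
    by rewrite (negPf mx) => /lt0.
  exists a, b; split; last by rewrite aE bE [a * _]mulrC [b * _]mulrC.
  - move=> m; rewrite -(msupp_mulX _ U_(x)%MM) -aE => /h1[_ /= /andP[_]].
    by rewrite coversDx.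
  - move=> m; rewrite -(msupp_mulX _ U_(y)%MM) -bE => /h2[_ /= /andP[_]].
    by rewrite coversDy.
move=> [a [b [ha hb ->]]]; apply: supportedD; rewrite mulrC.
  move=> m /msupp_mulXP[k /ha ck ->].
  by rewrite /= mnmDE mnm1E eqxx coversDx.
move=> m /msupp_mulXP[k /hb ck ->].
by rewrite /= !mnmDE !mnm1E eqxx orbT coversDy.
Qed.

(** [x] and [y] are coprime, so that x a + y b = 0 forces a = y c, and dividing by the
    fresh variable [y] does not affect the conditions imposed by [l]. *)
Lemma covers_regular (a b : S) :
  supported (covers l) a -> supported (covers l) b -> 'X_x * a + 'X_y * b = 0 ->
  exists c, [/\ supported (covers l) c, a = 'X_y * c & b = - ('X_x * c)].
Proof.
move=> ha hb ab.
have aE : a * 'X_x = - b * 'X_y.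
  by apply/eqP; rewrite -subr_eq0 mulNr opprK mulrC [b * _]mulrC ab.
have [c cE] : exists c, a = c * 'X_y.
  apply: supported_divX => m; rewrite -(msupp_mulX _ U_(x)%MM) aE => /msupp_mulXP[k _ E].
  apply/mnm_lepP=> j; rewrite mnm1E; case: eqP => // <-.
  by have /mnmP/(_ y) := E; rewrite !mnmDE !mnm1E eqxx (negPf xy) => E2; lia.
exists c; split; last 1 first.
- apply/eqP; rewrite -addr_eq0; apply/eqP/(mulfI (mpolyXU_neq0 F y)).
  by rewrite mulr0 -[RHS]ab cE; ring.
- move=> m; rewrite -(msupp_mulX _ U_(y)%MM) -cE => /ha.
  by rewrite coversDy.
- by rewrite cE mulrC.
Qed.

End Step.

Definition unit_rank (i : nat) : nat := (i == 0)%N.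

Fact unit_homog i (a : 'I_(unit_rank i.+1)) (b : 'I_(unit_rank i)) (m : mnm) :
  m \in msupp ((0 : 'M[S]_(unit_rank i.+1, unit_rank i)) a b) ->
  (mdeg m)%:Z + i%:Z = i.+1%:Z.
Proof. by rewrite mxE msupp0. Qed.

Definition unit_complex : graded_free_complex F n :=
  GradedFreeComplex (gfc_deg := fun i _ => i%:Z) unit_homog.

Lemma unit_resolution :
  ideal_resolution (C := unit_complex) (1%:M : 'M_1) (fun=> True).
Proof.
split.
- by move=> a; rewrite [a]ord1 mxE; exact: homdeg1.
- by move=> p; split=> // _; exists p%:M; rewrite mulmx1 mxE eqxx.
- move=> v; rewrite mulmx1; split=> [->|[w ->]]; last exact: mulmx0.
  by exists 0; rewrite mul0mx.
- move=> i v; split=> _; last exact: mulmx0.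
  by exists 0; rewrite mul0mx; apply/rowP=> -[].
Qed.

Definition flat_pairs (l : seq ('I_n * 'I_n)) := flatten [seq [:: e.1; e.2] | e <- l].

(** The ranks satisfy the recurrence of [prod_rank], which is the one of the
    coefficients of (2 + t)^k. *)
Theorem covers_resolution (l : seq ('I_n * 'I_n)) : uniq (flat_pairs l) ->
  exists (C : graded_free_complex F n) eps,
  [/\ ideal_resolution (C := C) eps (supported (covers l)),
      pure C (fun i => (size l)%:Z + i%:Z) &
      forall i, gfc_rank C i = ('C(size l, i) * 2 ^ (size l - i))%N].
Proof.
elim: l => [|[x y] l IH].
  exists unit_complex, (1%:M : 'M_1); split.
  - have [h1 h2 h3 h4] := unit_resolution; split=> // p; rewrite -h2; split=> // _.
  - by move=> i a; rewrite /= add0r.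
  - by case=> [|i]; rewrite ?bin0n.
rewrite /flat_pairs /= inE negb_or -/(flat_pairs l) => /and3P[/andP[xy xl] yl /IH].
move=> [C [eps [res pC rC]]].
have in_flat e : e \in l -> e.1 \in flat_pairs l /\ e.2 \in flat_pairs l.
  by move=> el; split; apply/flatten_mapP; exists e; rewrite ?inE ?eqxx ?orbT.
have xyl e : e \in l -> [/\ x != e.1, x != e.2, y != e.1 & y != e.2].
  move=> /in_flat[e1 e2]; split;
    [apply: contraNneq xl|apply: contraNneq xl|apply: contraNneq yl|apply: contraNneq yl];
    by move=> ->.
exists (prod_complex C (@homdegX F n x) (@homdegX F n y)), (prod_eps eps 'X_x 'X_y); split.
- apply: (prod_resolution _ _ _ (mpolyXU_neq0 F y) _ _ res); first by case: res.
    by move=> p; apply: covers_cons.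
  by move=> a b; apply: covers_regular.
- by move=> i a; rewrite (prod_pure pC) /= intS; ring.
- case=> [|i] /=; rewrite /prod_rank /= !rC; first by rewrite !bin0 !subn0 expnS; lia.
  rewrite binS subSS; case: (leqP i.+1 (size l)) => il.
    by rewrite mulnDl (_ : size l - i = (size l - i.+1).+1)%N ?expnS; lia.
  rewrite bin_small // !mul0n add0n; lia.
Qed.

End PairCovers.

(** * The resolution attached to the windows of three consecutive vertices *)

Section Band.
Local Open Scope ring_scope.
Variables (F : fieldType) (k : nat).
Hypothesis k4 : (4 < k)%N.
Local Notation n := k.+2.
Local Notation S := {mpoly F[n]}.
Local Notation mnm := 'X_{1..n}.
Implicit Types (i v : 'I_n) (b m : mnm).

(** Turns the cyclic arithmetic into linear arithmetic on [nat]. *)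
Lemma val_shift i j : (j < n)%N ->
  (i + j%:R)%R = (if i + j < n then i + j else i + j - n)%N :> nat.
Proof.
move=> jn; rewrite /= -[(j%:R : 'I_n)]/(j%:R : 'Z_n) Zp_nat /= (modn_small jn).
have ltin := ltn_ord i; case: (ltnP (i + j) n) => ij; first by rewrite modn_small.
by rewrite -[X in (X %% _)%N](subnK ij) modnDr modn_small //; lia.
Qed.

Lemma shift_eqE i j v : (j < n)%N ->
  (v == i + j%:R) = (v == (if i + j < n then i + j else i + j - n)%N :> nat).
Proof. by move=> jn; rewrite -(val_shift i jn). Qed.

Definition window i := [:: i; i + 1%:R; i + 2%:R].

Lemma windowE i v : v \in window i =
  [|| v == i :> nat, v == (if i + 1 < n then i + 1 else i + 1 - n)%N :> nat |
      v == (if i + 2 < n then i + 2 else i + 2 - n)%N :> nat].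
Proof. by rewrite !inE !shift_eqE //; lia. Qed.

(** The exponent of the squarefree monomial of the complement of a window. *)
Definition gap i : mnm := [multinom (v \notin window i) : nat | v < n].

Lemma gapE i v : gap i v = (v \notin window i).
Proof. exact: mnmE. Qed.

Lemma mdeg_gap i : mdeg (gap i) = (n - 3)%N.
Proof.
have u3 : uniq (window i).
  rewrite /= !inE !shift_eqE ?val_shift //; try lia.
  have := ltn_ord i; case: (ltnP (i + 1) n); case: (ltnP (i + 2) n); lia.
have sumE : mdeg (gap i) = #|predC (mem (window i))|.
  rewrite mdegE -sum1_card [RHS]big_mkcond; apply: eq_bigr => v _.
  by rewrite gapE !inE; case: ifP.
have := cardC (mem (window i)); rewrite card_ord (card_uniqP u3) /= -sumE; lia.
Qed.

(** The least common multiple of two consecutive generators, written in the two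
    possible ways. *)
Lemma gap_step i : (gap i + U_(i) = gap (i + 1%:R)%R + U_((i + 3%:R)%R))%MM.
Proof.
apply/mnmP=> v; rewrite !mnmDE !gapE !windowE !mnm1E ![_ == v]eq_sym shift_eqE ?val_shift; try lia.
rewrite -val_eqE /=; have := ltn_ord i; have := ltn_ord v.
case: (ltnP (i + 1) n) => h1; case: (ltnP (i + 2) n) => h2;
  case: (ltnP (i + 3) n) => h3; repeat (case: ltnP => ?); lia.
Qed.

Lemma shiftS i (j : nat) : i + j.+1%:R = i + j%:R + 1%:R.
Proof. by rewrite -addrA -natrD addn1. Qed.

Lemma shiftD i (j l : nat) : i + j%:R + l%:R = i + (j + l)%:R.
Proof. by rewrite -addrA -natrD. Qed.

Lemma windowP i v : reflect (exists2 j, (j < 3)%N & v = i + j%:R) (v \in window i).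
Proof.
apply: (iffP idP); rewrite !inE.
  case/or3P=> /eqP ->; [exists 0%N|exists 1%N|exists 2%N] => //.
  by rewrite addr0.
by case=> -[|[|[|j]]] // _ ->; rewrite ?addr0 eqxx ?orbT.
Qed.

Lemma shift_inj i j l : (j < n)%N -> (l < n)%N -> i + j%:R = i + l%:R -> j = l.
Proof.
move=> jn ln /(congr1 (@nat_of_ord n)); rewrite !val_shift //.
have ltin := ltn_ord i; case: (ltnP (i + j) n) => ?; case: (ltnP (i + l) n) => ?; lia.
Qed.

Lemma adjE (u v : 'I_n) : cycle_square u v =
  [|| v == u + 1%:R, v == u + 2%:R, u == v + 1%:R | u == v + 2%:R].
Proof.
have E (x y : 'I_n) j : (j < n)%N -> (y == x + j %[mod n])%N = (y == x + j%:R).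
  move=> jn; rewrite shift_eqE // (modn_small (ltn_ord y)).
  have ltxn := ltn_ord x; case: (ltnP (x + j) n) => xj; first by rewrite modn_small.
  by rewrite -[X in _ == (X %% _)%N](subnK xj) modnDr modn_small //; lia.
by rewrite /cycle_square !E //; lia.
Qed.

Lemma adj_shift (u : 'I_n) j : (j < n)%N -> cycle_square u (u + j%:R) ->
  [|| j == 1, j == 2, j == n - 1 | j == n - 2]%N.
Proof.
move=> jn; rewrite adjE => /or4P[] /eqP.
- by move/shift_inj => -> //; lia.
- by move/shift_inj => -> //; lia.
- rewrite shiftD => E; have /shift_inj : u + 0%:R = u + (j + 1)%:R by rewrite addr0.
  have [jn1|jn1] := ltnP (j + 1) n; first by move=> /(_ isT isT); lia.
  by move=> _; lia.
- rewrite shiftD => E; have /shift_inj : u + 0%:R = u + (j + 2)%:R by rewrite addr0.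
  have [jn1|jn1] := ltnP (j + 2) n; first by move=> /(_ isT isT); lia.
  by move=> _; lia.
Qed.

Lemma window_adj i u v : u \in window i -> v \in window i -> u != v ->
  cycle_square u v.
Proof.
move=> /windowP[j j3 ->] /windowP[l l3 ->]; rewrite adjE.
by case: j j3 => [|[|[|j]]] // _; case: l l3 => [|[|[|l]]] // _; rewrite !shiftD !eqxx ?orbT.
Qed.

(** Since n > 6, a vertex is adjacent neither to the third nor to the fourth one after
    it.  So the window may start at the element of [Z] that lies farthest before a
    given [z] in [Z], among those at most two steps back. *)
Lemma clique_window (Z : pred 'I_n) :
  (forall u v, Z u -> Z v -> u != v -> cycle_square u v) ->
  exists i, forall v, Z v -> v \in window i.
Proof.
move=> cl; have [/existsP[z Zz]|/existsPn Z0] := boolP [exists z, Z z]; last first.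
  by exists 0 => v Zv; have := Z0 v; rewrite Zv.
have sym (u v : 'I_n) : cycle_square u v = cycle_square v u.
  by rewrite !adjE; do 4 case: eqP.
have far v j : (2 < j < 5)%N -> Z v -> Z (v + j%:R) -> False.
  move=> j5 Zv Zvj; have jn : (j < n)%N by lia.
  have /(cl _ _ Zv Zvj)/(adj_shift jn) : v != v + j%:R; last by lia.
  apply/eqP => E; have /shift_inj : v + 0%:R = v + j%:R by rewrite addr0.
  by move=> /(_ isT jn); lia.
have fit y : Z y -> (forall v, Z v -> y = v + 1%:R \/ y = v + 2%:R -> False) ->
    forall v, Z v -> v \in window y.
  move=> Zy noy v Zv; rewrite !inE; have [//|vy] := eqVneq v y.
  have := cl _ _ Zy Zv; rewrite eq_sym adjE => /(_ vy) /or4P[] /eqP E.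
  - by rewrite E eqxx.
  - by rewrite E eqxx orbT.
  - by case: (noy _ Zv); left.
  - by case: (noy _ Zv); right.
(* try the start z - 2, then z - 1; if neither is in Z, the window starts at z *)
have [/existsP[y /andP[Zy /eqP zy]]|/existsPn no2] := boolP [exists y, Z y && (z == y + 2%:R)].
  exists y; apply: fit => // v Zv [] yv; apply: (far v _ _ Zv).
    by instantiate (1 := 3).
    by rewrite zy yv shiftD in Zz.
    by instantiate (1 := 4).
    by rewrite zy yv shiftD in Zz.
have [/existsP[y /andP[Zy /eqP zy]]|/existsPn no1] := boolP [exists y, Z y && (z == y + 1%:R)].
  exists y; apply: fit => // v Zv [] yv.
    by have := no2 v; rewrite Zv zy yv shiftD eqxx.
  apply: (far v 3 _ Zv) => //.
  by rewrite zy yv shiftD in Zz.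
exists z; apply: fit => // v Zv [] zv.
  by have := no1 v; rewrite Zv zv eqxx.
by have := no2 v; rewrite Zv zv eqxx.
Qed.

Lemma gap_leP b i : reflect (forall v, b v = 0%N -> v \in window i) (gap i <= b)%MM.
Proof.
apply: (iffP mnm_lepP) => h v; have := h v; rewrite gapE.
  by case: (v \in window i) => // + b0; rewrite b0.
by case: (b v) => [/(_ erefl) ->|//]; case: (v \in window i).
Qed.

Definition band_rank (i : nat) : nat :=
  match i with 0 | 1 => n | 2 => 1 | _ => 0 end.

(** From homological degree 3 on the modules are zero, and the degrees are only
    chosen so that consecutive ones always differ. *)
Definition band_deg (i : nat) : int :=
  match i with 0 => (n - 3)%N%:Z | 1 => (n - 2)%N%:Z | j => (n + j)%N%:Z - 2 end.

Definition band_eps : 'cV[S]_n := \col_i 'X_[gap i].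

Definition band_syz : 'M[S]_(n, n) := \matrix_(i, j)
  ((if j == i then 'X_i else 0) - (if j == i + 1%:R then 'X_(i + 3%:R) else 0)).

Definition band_top : 'M[S]_(1, n) := \row_i ('X_(i + 1%:R) * 'X_(i + 2%:R)).

Definition band_diff (i : nat) : 'M[S]_(band_rank i.+1, band_rank i) :=
  match i with 0 => band_syz | 1 => band_top | _ => 0 end.

Fact band_homog (i : nat) (a : 'I_(band_rank i.+1)) (b : 'I_(band_rank i)) m :
  m \in msupp (band_diff i a b) -> (mdeg m)%:Z + band_deg i = band_deg i.+1.
Proof.
case: i a b => [|[|i]] a b /= mab; last by case: (a).
  have : homdeg 1 (band_syz a b).
    rewrite mxE; apply: homdegD; first by case: ifP => _; [exact: homdegX|exact: homdeg0].
    by apply: homdegN; case: ifP => _; [exact: homdegX|exact: homdeg0].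
  by move=> /(_ m mab) ->; lia.
move: mab; rewrite mxE => mab.
by have := homdegM (@homdegX F n (b + 1%:R)) (@homdegX F n (b + 2%:R)) mab; lia.
Qed.

(** Generators indexed by windows; relations between consecutive windows; one
    relation between these relations, because the windows close up into a cycle. *)
Definition band_complex : graded_free_complex F n :=
  GradedFreeComplex (gfc_deg := fun (i : nat) _ => band_deg i) band_homog.

Lemma mul_band_syz (w : 'rV[S]_n) i :
  (w *m band_syz) 0 (i + 1%:R) =
  w 0 (i + 1%:R) * 'X_(i + 1%:R) - w 0 i * 'X_(i + 3%:R).
Proof.
rewrite mxE (eq_bigr (fun j => (if j == i + 1%:R then w 0 j * 'X_j else 0) -
    (if j == i then w 0 j * 'X_(j + 3%:R) else 0))); last first.
  move=> j _; rewrite mxE mulrBr (eq_sym _ j) (inj_eq (addIr 1%:R)) (eq_sym i).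
  by do 2 case: eqP => _; rewrite ?mulr0.
by rewrite sumrB -!big_mkcond !big_pred1_eq.
Qed.

Lemma mul_band_eps (w : 'rV[S]_n) : (w *m band_eps) 0 0 = \sum_i w 0 i * 'X_[gap i].
Proof. by rewrite mxE; apply: eq_bigr => i _; rewrite mxE. Qed.

Lemma band_syz_row i :
  (delta_mx 0 i : 'rV_n) *m band_syz = 'X_i *: delta_mx 0 i - 'X_(i + 3%:R) *: delta_mx 0 (i + 1%:R).
Proof.
rewrite -rowE; apply/rowP=> j; rewrite !mxE eqxx /=.
by do 2 case: eqP => _; rewrite ?mulr1 ?mulr0.
Qed.

Lemma band_syz_eps : band_syz *m band_eps = 0.
Proof.
apply/row_matrixP=> i; rewrite row0 rowE mulmxA band_syz_row.
apply/rowP=> j; rewrite [j]ord1 mulmxBl -!scalemxAl -!rowE !mxE -!mpolyXD.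
by rewrite addmC gap_step addmC subrr.
Qed.

Lemma band_top_syz : band_top *m band_syz = 0.
Proof.
apply/rowP=> j; rewrite -[j](subrK 1%:R) mul_band_syz !mxE !shiftD.
set i := j - 1%:R; apply/eqP; rewrite subr_eq0; apply/eqP; ring.
Qed.

(** The relation reads v_(i+1) x_(i+1) = v_i x_(i+3) for all [i].  Hence v_i is
    divisible by x_(i+1), and by x_(i+2), and the quotients are all equal. *)
Lemma band_exact2 (v : 'rV[S]_n) : v *m band_syz = 0 -> exists w, v = w *m band_top.
Proof.
move=> v0.
have vE i : v 0 (i + 1%:R) * 'X_(i + 1%:R) = v 0 i * 'X_(i + 3%:R).
  by apply/eqP; rewrite -subr_eq0 -mul_band_syz v0 mxE.
have vE' i : v 0 i * 'X_i = v 0 (i - 1%:R) * 'X_(i + 2%:R).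
  have := vE (i - 1%:R); rewrite subrK => ->; congr (_ * 'X_(_)).
  by rewrite -addrA (natrD _ 1 2) addKr.
have neq i j l : (j < n)%N -> (l < n)%N -> j != l -> i + j%:R == i + l%:R = false.
  by move=> jn ln jl; apply: contraNF jl => /eqP /(shift_inj jn ln) ->.
have neq0 i l : (0 < l < n)%N -> i == i + l%:R = false.
  by move=> ln; have := neq i 0%N l; rewrite addr0 => -> //; lia.
have /fin_all_exists[d dP] i : exists d, v 0 i = d * ('X_(i + 1%:R) * 'X_(i + 2%:R)).
  rewrite -mpolyXD; apply: supported_divX => m mv.
  apply/mnm_lepP=> j; rewrite mnmDE !mnm1E.
  have h1 : (0 < m (i + 1%:R)%R)%N.
    have : (U_((i + 3%:R)%R) + m)%MM \in msupp (v 0 (i + 1%:R) * 'X_(i + 1%:R)).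
      by rewrite vE msupp_mulX.
    move/msupp_mulXP => [m' _ /mnmP/(_ (i + 1%:R)%R)].
    rewrite !mnmDE !mnm1E eqxx neq; lia.
  have h2 : (0 < m (i + 2%:R)%R)%N.
    have : (U_(i) + m)%MM \in msupp (v 0 (i - 1%:R) * 'X_(i + 2%:R)).
      by rewrite -vE' msupp_mulX.
    move/msupp_mulXP => [m' _ /mnmP/(_ (i + 2%:R)%R)].
    by rewrite !mnmDE !mnm1E eqxx neq0 //=; lia.
  case: (eqVneq (i + 1%:R) j) => [<-|_]; first by rewrite neq //=; lia.
  by case: (eqVneq (i + 2%:R) j) => [<-|_].
have dS i : d (i + 1%:R) = d i.
  apply: (mulIf (mpolyXU_neq0 _ (i + 3%:R))); apply: (mulIf (mpolyXU_neq0 _ (i + 1%:R))).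
  apply: (mulIf (mpolyXU_neq0 _ (i + 2%:R))).
  have := vE i; rewrite !dP !shiftD => E.
  by transitivity (d (i + 1%:R) * ('X_(i + 2%:R) * 'X_(i + 3%:R)) * 'X_(i + 1%:R));
    [ring|rewrite E; ring].
have d0 i : d i = d 0.
  have dj (j : nat) : d (0 + j%:R) = d 0.
    by elim: j => [|j IH]; [rewrite addr0|rewrite shiftS dS].
  by rewrite -(dj i) add0r; congr d; apply/esym/(natr_Zp (i : 'Z_n)).
exists (d 0)%:M; apply/rowP=> i; rewrite mul_scalar_mx !mxE dP d0 //.
Qed.

Lemma band_top_inj (w : 'rV[S]_1) : w *m band_top = 0 -> w = 0.
Proof.
move=> /rowP/(_ 0); rewrite !mxE big_ord1 !mxE => /eqP.
rewrite !mulf_eq0 !(negPf (mpolyXU_neq0 _ _)) !orbF => /eqP w0.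
by apply/rowP=> i; rewrite ord1 mxE.
Qed.

Definition syzygy (v : 'rV[S]_n) := exists w, v = w *m band_syz.

Lemma syzygy0 : syzygy 0. Proof. by exists 0; rewrite mul0mx. Qed.
Lemma syzygyD (u v : 'rV_n) : syzygy u -> syzygy v -> syzygy (u + v).
Proof. by move=> [w ->] [x ->]; exists (w + x); rewrite mulmxDl. Qed.
Lemma syzygyZ a (v : 'rV_n) : syzygy v -> syzygy (a *: v).
Proof. by move=> [w ->]; exists (a *: w); rewrite scalemxAl. Qed.
Lemma syzygyN (v : 'rV_n) : syzygy v -> syzygy (- v).
Proof. by move=> [w ->]; exists (- w); rewrite mulNmx. Qed.

(** The multiple of the [i]-th basis vector that [band_eps] sends to the monomial
    [b], when the [i]-th generator divides it. *)
Definition lift_mnm b i : 'rV[S]_n := 'X_[b - gap i] *: delta_mx 0 i.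

Lemma lift_step b i : (gap i <= b)%MM -> (gap (i + 1%:R)%R <= b)%MM ->
  syzygy (lift_mnm b i - lift_mnm b (i + 1%:R)).
Proof.
move=> b0 b1; pose m := (b - (gap i + U_(i)))%MM.
have gi : (gap i + U_(i) <= b)%MM.
  apply/mnm_lepP=> v; have /mnmP/(_ v) := gap_step i.
  have := mnm_lepP b0 v; have := mnm_lepP b1 v.
  rewrite !mnmDE !mnm1E; case: (eqVneq i v) => [->|_]; last by lia.
  have -> : (v + 3%:R == v) = false.
    apply/eqP => E; have /shift_inj : v + 3%:R = v + 0%:R by rewrite addr0.
    have n3 : (3 < n)%N by lia.
    by move=> /(_ n3 isT).
  by rewrite (gapE v v) inE eqxx /=; lia.
have E0 : (b - gap i = m + U_(i))%MM.
  apply/mnmP=> v; have := mnm_lepP gi v; rewrite /m !(mnmDE, mnmBE); lia.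
have E1 : (b - gap (i + 1%:R)%R = m + U_((i + 3%:R)%R))%MM.
  move: gi; rewrite /m gap_step => gi.
  apply/mnmP=> v; have := mnm_lepP gi v; rewrite !(mnmDE, mnmBE); lia.
rewrite /lift_mnm E0 E1 !mpolyXD -!scalerA -scalerBr -band_syz_row.
by apply: syzygyZ; eexists.
Qed.

(** The generators dividing [b] correspond to the windows containing all the
    vertices where [b] vanishes.  If there is no such vertex, all windows occur and
    they are connected around the cycle; otherwise they contain a common vertex, so
    they are at most two steps apart, and if two steps apart then the window in
    between occurs as well. *)
Lemma lift_connected b i i' : (gap i <= b)%MM -> (gap i' <= b)%MM ->
  syzygy (lift_mnm b i - lift_mnm b i').
Proof.
have trans j l p : syzygy (lift_mnm b j - lift_mnm b l) ->
    syzygy (lift_mnm b l - lift_mnm b p) -> syzygy (lift_mnm b j - lift_mnm b p).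
  by move=> h1 h2; have := syzygyD h1 h2; rewrite addrA subrK.
have [/existsP[z /eqP bz]|/existsPn nz] := boolP [exists z, b z == 0%N]; last first.
  have all_le j : (gap j <= b)%MM by apply/gap_leP => v bv; have := nz v; rewrite bv.
  pose t : 'I_n := i' - i.
  move=> _ _; have -> : i' = i + t%:R by rewrite [t%:R](natr_Zp (t : 'Z_n)) addrC subrK.
  elim: (nat_of_ord t) => [|j IH]; first by rewrite addr0 subrr; exact: syzygy0.
  by apply: trans IH _; rewrite shiftS; apply: lift_step.
have up a c : (gap a <= b)%MM -> (gap (a + c%:R)%R <= b)%MM -> (c < 3)%N ->
    syzygy (lift_mnm b a - lift_mnm b (a + c%:R)).
  case: c => [|[|[|c]]] // ga gc _.
  - by rewrite addr0 subrr; exact: syzygy0.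
  - exact: lift_step.
  - have g1 : (gap (a + 1%:R)%R <= b)%MM.
      apply/gap_leP => v bv; have /windowP[j j3 vj] := gap_leP _ _ ga v bv.
      have /windowP[l l3 vl] := gap_leP _ _ gc v bv.
      have jl : j = (2 + l)%N.
        by apply: (@shift_inj a); [lia|lia|rewrite -vj -shiftD -vl].
      apply/windowP; exists 1%N => //; rewrite shiftD vj; congr (a + _%:R); lia.
    have E : a + 2%:R = a + 1%:R + 1%:R := shiftS a 1.
    by apply: trans (lift_step ga g1) _; rewrite E in gc *; exact: lift_step g1 gc.
move=> gi gi'; have /windowP[j j3 zj] := gap_leP _ _ gi z bz.
have /windowP[l l3 zl] := gap_leP _ _ gi' z bz.
have [jl|lj] := leqP l j.
  have E : i' = i + (j - l)%:R.
    by apply: (addIr l%:R); rewrite -zl zj shiftD subnK.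
  by rewrite E; apply: up; rewrite -?E //; lia.
have E : i = i' + (l - j)%:R.
  by apply: (addIr j%:R); rewrite -zj zl shiftD subnK // ltnW.
by rewrite -opprB; apply: syzygyN; rewrite E; apply: up; rewrite -?E //; lia.
Qed.

Definition lift_any b : 'rV[S]_n :=
  if [pick i | (gap i <= b)%MM] is Some i then lift_mnm b i else 0.

(** The linear extension to polynomials of a choice of lift for each monomial. *)
Definition lift_poly (p : S) : 'rV[S]_n :=
  \sum_(m <- msupp p) (p@_m)%:MP *: lift_any m.

Lemma lift_polyD p q : lift_poly (p + q) = lift_poly p + lift_poly q.
Proof.
have bounded l (r : S) : (msize r <= l)%N ->
    lift_poly r = \sum_(m : 'X_{1..n < l}) (r@_m)%:MP *: lift_any m.
  move=> rl; pose I : subFinType _ := 'X_{1..n < l}.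
  rewrite /lift_poly (big_mksub I) //=; first last.
  + by move=> x /msize_mdeg_lt /leq_trans /(_ rl) ->.
  + by rewrite msupp_uniq.
  by rewrite big_rmcond //= => m /memN_msupp_eq0 ->; rewrite mpolyC0 scale0r.
pose l := (msize (p + q) + msize p + msize q)%N.
rewrite !(bounded l) ?/l; try lia.
rewrite -big_split; apply: eq_bigr => m _.
by rewrite mcoeffD mpolyCD scalerDl.
Qed.

Lemma lift_poly0 : lift_poly 0 = 0.
Proof. by rewrite /lift_poly msupp0 big_nil. Qed.

Lemma lift_poly_term c m : lift_poly (c *: 'X_[m]) = c%:MP *: lift_any m.
Proof.
have [->|c0] := eqVneq c 0; first by rewrite scale0r lift_poly0 mpolyC0 scale0r.
by rewrite /lift_poly msuppMCX // big_seq1 mcoeffZ mcoeffX eqxx mulr1.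
Qed.

(** By [lift_connected], modulo syzygies a term depends only on its image in [S]. *)
Lemma lift_polyP (p : S) i :
  syzygy (p *: delta_mx 0 i - lift_poly (p * 'X_[gap i])).
Proof.
rewrite [p]mpolyE; elim/big_ind: _ => [|x y hx hy|m _].
- by rewrite scale0r mul0r lift_poly0 subr0; exact: syzygy0.
- by have := syzygyD hx hy; rewrite mulrDl lift_polyD scalerDl opprD addrACA.
rewrite -scalerAl -mpolyXD lift_poly_term -mul_mpolyC -scalerA -scalerBr.
apply: syzygyZ; have le : (gap i <= m + gap i)%MM.
  by apply/mnm_lepP=> v; rewrite mnmDE leq_addl.
rewrite /lift_any; case: pickP => [i' gi'|/(_ i)]; last by rewrite le.
by have := lift_connected le gi'; rewrite {1}/lift_mnm addmK.
Qed.

(** Modulo syzygies, [v] equals the chosen lift of its image under [band_eps], which is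
    zero. *)
Lemma band_exact1 (v : 'rV[S]_n) : v *m band_eps = 0 -> syzygy v.
Proof.
move=> v0; have E : \sum_i v 0 i * 'X_[gap i] = 0 by rewrite -mul_band_eps v0 mxE.
have lift0 : \sum_i lift_poly (v 0 i * 'X_[gap i]) = 0.
  by rewrite -(big_morph lift_poly lift_polyD lift_poly0) E lift_poly0.
have -> : v = \sum_i (v 0 i *: delta_mx 0 i - lift_poly (v 0 i * 'X_[gap i])).
  by rewrite sumrB lift0 subr0 -row_sum_delta.
elim/big_ind: _ => [|x y|i _]; [exact: syzygy0|exact: syzygyD|exact: lift_polyP].
Qed.

Theorem band_resolution (I : S -> Prop) :
  (forall p, I p <-> supported (fun m => exists i, (gap i <= m)%MM) p) ->
  ideal_resolution (C := band_complex) band_eps I.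
Proof.
move=> IE; split.
- move=> a m; rewrite mxE msuppX inE => /eqP ->; by rewrite mdeg_gap.
- move=> p; rewrite IE.
  have -> : (fun m => exists i, (gap i <= m)%MM) = up (fun m => exists i, m = gap i).
    rewrite predeqE => m; split=> [[i gi]|[_ [i ->] gi]]; last by exists i.
    by exists (gap i) => //; exists i.
  rewrite -monomial_idealP; split; last first.
    move=> [v ->]; rewrite mul_band_eps.
    elim/big_ind: _ => [|x y|i _]; [exact: ideal_has0|exact: ideal_add|].
    by apply/ideal_mul/ideal_genW; exists (gap i) => //; exists i.
  pose T (p : S) := exists v : 'rV_n, p = (v *m band_eps) 0 0.
  have T0 : T 0 by exists 0; rewrite mul0mx mxE.
  have TD x y : T x -> T y -> T (x + y).
    by move=> [v ->] [w ->]; exists (v + w); rewrite mulmxDl [RHS]mxE.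
  have TM a x : T x -> T (a * x).
    by move=> [v ->]; exists (a *: v); rewrite -scalemxAl [RHS]mxE.
  apply: (ideal_gen_le (I := Ideal T0 TD TM)) => _ [_ [i ->] <-].
  by exists (delta_mx 0 i); rewrite -rowE !mxE.
- move=> v; split; first exact: band_exact1.
  by move=> [w ->]; rewrite -mulmxA band_syz_eps mulmx0.
- case=> [|[|i]] v /=; split.
  + exact: band_exact2.
  + by move=> [w ->]; rewrite -mulmxA band_top_syz mulmx0.
  + by move/band_top_inj => ->; exists 0; rewrite mul0mx.
  + by move=> [w ->]; rewrite mulmx0 mul0mx.
  + by move=> _; exists 0; rewrite mul0mx; apply/rowP=> -[].
  + by move=> _; rewrite mulmx0.
Qed.

End Band.

(** * Total cut complexes of pairs *)

Section TotalCut.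

Lemma total_cut_down (V : finType) (e : rel V) k (A B : {set V}) :
  A \subset B -> B \in total_cut_complex e k -> A \in total_cut_complex e k.
Proof.
move=> AB; rewrite !inE => /existsP[M /and3P[iM cM BM]].
by apply/existsP; exists M; rewrite iM cM (fintype.subset_trans AB BM).
Qed.

Lemma total_cut2P (V : finType) (e : rel V) (A : {set V}) :
  ssrbool.symmetric e -> irreflexive e ->
  reflect (exists u v, [/\ u != v, ~~ e u v, u \notin A & v \notin A])
          (A \in total_cut_complex e 2).
Proof.
move=> se ie; rewrite inE; apply: (iffP existsP).
  move=> [M /and3P[/forall_inP iM /cards2P[u [v [uv ME]]] AM]].
  have uM : u \in M by rewrite ME !inE eqxx.
  have vM : v \in M by rewrite ME !inE eqxx orbT.
  exists u, v; split=> //.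
  - by have /forall_inP := iM _ uM; apply.
  - by apply/negP => /(fintype.subsetP AM); rewrite inE uM.
  - by apply/negP => /(fintype.subsetP AM); rewrite inE vM.
move=> [u [v [uv euv uA vA]]]; exists [set u; v]; apply/and3P; split.
- apply/forall_inP => x; rewrite !inE => /orP[] /eqP ->;
    apply/forall_inP => y; rewrite !inE => /orP[] /eqP ->; rewrite ?ie //.
  by rewrite se.
- by rewrite cards2 uv.
- apply/fintype.subsetP => x xA; rewrite !inE negb_or.
  by apply/andP; split; [apply: contraNneq uA|apply: contraNneq vA] => <-.
Qed.

Lemma cycle_square_sym n : ssrbool.symmetric (@cycle_square n).
Proof. by move=> u v; rewrite /cycle_square; do 4 case: eqP. Qed.

Lemma cycle_square_irr n : (2 < n)%N -> irreflexive (@cycle_square n).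
Proof.
move=> n2 u; have ne j : (0 < j < n)%N -> (u == u + j %[mod n])%N = false.
  move=> jn; rewrite -{1}[nat_of_ord u]addn0 eqn_modDl mod0n modn_small; lia.
by rewrite /cycle_square !ne //; lia.
Qed.

End TotalCut.

(** * Squares of cycles *)

Section Conclusions.
Local Open Scope ring_scope.
Variables (F : fieldType).

Lemma graded_betti_pure n (C : graded_free_complex F n) eps d (I : ideal {mpoly F[n]}) i j :
  (forall d p, I p -> I (hpart d p)) ->
  ideal_resolution (C := C) eps I -> pure C d -> d 0%N != 0 ->
  (forall i, d i.+1 != d i) ->
  graded_betti I i j =
    if i is i'.+1 then if d i' == j then gfc_rank C i' else 0%N else (j == 0 : nat).
Proof.
move=> Ih res pC d0 dS; have [eh _ _ _] := res.
rewrite (tor_dim_resolution Ih _ _ (augment_resolves eh res)).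
rewrite (@tor_dim_pure _ _ _ (fun i => if i is i'.+1 then d i' else 0)).
- by case: i => [|i] //=; rewrite eq_sym; case: eqP.
- by case=> [|k] a //=; exact: pC.
- by case=> [|k] //=.
Qed.

Section SquareCycle.
Variable n : nat.
Hypothesis n2 : (2 < n)%N.
Let Delta := total_cut_complex (@cycle_square n) 2.
Let I := sr_ideal F Delta.

Lemma sr_total_cutP p : I p <-> supported (fun m => vars m \notin Delta) p.
Proof. by apply: sr_idealP => A B; exact: total_cut_down. Qed.

Lemma sr_total_cut_hpart d p : I p -> I (hpart d p).
Proof. by rewrite !sr_total_cutP; exact: supported_hpart. Qed.

Lemma total_cut_varsP (m : 'X_{1..n}) :
  vars m \in Delta <->
  exists u v, [/\ u != v, ~~ cycle_square u v, m u = 0%N & m v = 0%N].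
Proof.
have E w : (w \notin vars m) = (m w == 0%N) by rewrite inE -eqn0Ngt.
split.
  case/(total_cut2P _ (@cycle_square_sym n) (cycle_square_irr n2)) => u [v [h1 h2]].
  by rewrite !E => /eqP ? /eqP ?; exists u, v.
move=> [u [v [h1 h2 /eqP h3 /eqP h4]]].
by apply/(total_cut2P _ (@cycle_square_sym n) (cycle_square_irr n2)); exists u, v; rewrite !E.
Qed.

(** The complement of an independent pair is a facet, which contributes the prime
    generated by the two variables of the pair. *)
Lemma sr_total_cut_vprime (u v : 'I_n) p :
  u != v -> ~~ cycle_square u v -> I p -> vprime (pred2 u v) p.
Proof.
move=> uv euv /sr_total_cutP hp m /hp; have [mu|mu] := posnP (m u); last first.
  by move=> _; exists u => //=; rewrite eqxx.
have [mv|mv] := posnP (m v); last by move=> _; exists v => //=; rewrite eqxx orbT.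
by move/negP; case; apply/total_cut_varsP; exists u, v.
Qed.

End SquareCycle.

(** A set is a nonface when its complement is a clique, and cliques are the sets
    contained in a window. *)
Lemma sr_band k (p : {mpoly F[k.+2]}) : (4 < k)%N ->
  sr_ideal F (total_cut_complex (@cycle_square k.+2) 2) p <->
  supported (fun m => exists i, (gap i <= m)%MM) p.
Proof.
move=> k4; rewrite (@sr_total_cutP k.+2); split=> hp m /hp.
  move=> mD; have [|i iP] := clique_window k4 (Z := fun v => m v == 0%N).
    move=> u v /eqP mu /eqP mv uv; apply: contraR mD => euv.
    by apply/total_cut_varsP; first lia; exists u, v.
  by exists i; apply/gap_leP => v /eqP; exact: iP.
move=> [i /gap_leP gi]; apply/negP => /total_cut_varsP[].
  by lia.
move=> u [v [uv /negP euv /gi ui /gi vi]]; apply: euv.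
exact: window_adj ui vi uv.
Qed.

(** Nonvanishing Betti numbers in bidegrees (1, n - 3) and (3, n) would both have to
    lie on the line j = s + i - 1. *)
Lemma cycle_square_large n : (6 < n)%N ->
  let Delta := total_cut_complex (@cycle_square n) 2 in
  ~ linear_resolution (sr_ideal F Delta) /\ ~ cohen_macaulay (sr_ring F Delta).
Proof.
case: n => [|[|k]] // k4 /=; have {}k4 : (4 < k)%N by lia.
have res := band_resolution k4 (fun p => sr_band p k4).
have n2 : (2 < k.+2)%N by lia.
have pC : pure (band_complex F k4) (band_deg k) by [].
have d0 : band_deg k 0 != 0 by rewrite /=; lia.
have dS i : band_deg k i.+1 != band_deg k i by case: i => [|[|i]] /=; lia.
split.
  move=> [s [s1 [_ lin]]].
  have betti i j := graded_betti_pure i j (@sr_total_cut_hpart k.+2) res pC d0 dS.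
  have s3 : s%:Z = (k.+2 - 3)%N%:Z.
    apply/eqP/contraT => /eqP sd; have := lin 1%N (band_deg k 0) isT.
    by rewrite betti eqxx /= => h; suff: k.+2 = 0%N by []; apply: h; lia.
  have := lin 3%N (band_deg k 2) isT; rewrite betti eqxx /= => h.
  by suff: 1%N = 0%N by []; apply: h; lia.
(* 0 and 3 are independent *)
have e03 : ~~ cycle_square (0 : 'I_k.+2) (3%:R).
  apply/negP; rewrite -[3%:R]add0r => /(adj_shift k4).
  by move=> h; have := h _; lia.
have ne03 : (0 : 'I_k.+2) != 3%:R.
  apply/eqP => E; have /(shift_inj k4) : (0 : 'I_k.+2) + 0%:R = 0 + 3%:R by rewrite addr0 add0r.
  by move=> h; have := h _ _; lia.
apply: (not_cohen_macaulay (q := 0) (i := 0) (j := 3%:R) res) => //.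
  exact: (pure_minimal pC).
by move=> p; apply: sr_total_cut_vprime.
Qed.

Definition antipodes : seq ('I_6 * 'I_6) :=
  [:: (@Ordinal 6 0 isT, @Ordinal 6 3 isT); (@Ordinal 6 1 isT, @Ordinal 6 4 isT);
      (@Ordinal 6 2 isT, @Ordinal 6 5 isT)].

Lemma antipodesP (u v : 'I_6) : u != v -> ~~ cycle_square u v ->
  ((u, v) \in antipodes) || ((v, u) \in antipodes).
Proof.
by case: u => [[|[|[|[|[|[|u]]]]]] hu] //; case: v => [[|[|[|[|[|[|v]]]]]] hv] //.
Qed.

Lemma sr_antipodes (p : {mpoly F[6]}) :
  sr_ideal F (total_cut_complex (@cycle_square 6) 2) p <->
  supported (covers antipodes) p.
Proof.
rewrite (@sr_total_cutP 6); split=> hp m /hp.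
  move=> mD; have far u v : u != v -> ~~ cycle_square u v -> (0 < m u)%N || (0 < m v)%N.
    move=> uv euv; apply: contraR mD; rewrite negb_or -!eqn0Ngt => /andP[/eqP mu /eqP mv].
    by apply/total_cut_varsP => //; exists u, v.
  by rewrite /covers /= !far.
move=> /allP cov; apply/negP => /total_cut_varsP[] // u [v [uv euv mu mv]].
by case/orP: (antipodesP uv euv) => /cov; rewrite /= mu mv.
Qed.

Lemma cycle_square_six :
  let Delta := total_cut_complex (@cycle_square 6) 2 in
  let beta := graded_betti (sr_ideal F Delta) in
  linear_resolution (sr_ideal F Delta) /\
  [/\ beta 0%N (Posz 0) = 1%N, beta 4%N (Posz 6) = 1%N, beta 1%N (Posz 3) = 8%N,
      beta 2%N (Posz 4) = 12%N & beta 3%N (Posz 5) = 6%N] /\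
  (forall (i : nat) (j : int),
     (i, j) \notin [:: (0%N, Posz 0); (4%N, Posz 6); (1%N, Posz 3); (2%N, Posz 4); (3%N, Posz 5)] ->
     beta i j = 0%N) /\
  ~ cohen_macaulay (sr_ring F Delta).
Proof.
move=> Delta beta.
have [C [eps [[eh epsI exe exd] pC rC]]] := @covers_resolution F 6 antipodes isT.
have res : ideal_resolution (C := C) eps (sr_ideal F Delta).
  by split=> // p; rewrite sr_antipodes.
have betti i j : beta i j = if i is i'.+1 then if (3 + i'%:Z == j) then ('C(3, i') * 2 ^ (3 - i'))%N
    else 0%N else (j == 0 : nat).
  rewrite /beta (graded_betti_pure i j (@sr_total_cut_hpart 6) res pC) //.
    by case: i => // i; rewrite rC.
  by move=> k /=; lia.
split.
  exists 3%N; split=> //; split.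
    by apply: (resolution_generated res) => a; rewrite pC.
  move=> [|i] j // _ ne; rewrite -/(beta _ _) betti; case: eqP => // E; case: ne; rewrite -E; lia.
split; first by split; rewrite betti.
split.
  move=> i j; rewrite betti !inE !xpair_eqE.
  case: i => [|i] /=; first by case: eqP.
  case: (3 + i%:Z =P j) => // <-; case: i => [|[|[|[|i]]]] //.
apply: (not_cohen_macaulay (q := 1) (i := @Ordinal 6 0 isT) (j := @Ordinal 6 3 isT) res) => //.
- by rewrite rC.
- by apply: (pure_minimal pC) => /=; lia.
by move=> p; apply: sr_total_cut_vprime.
Qed.

End Conclusions.

Theorem theorem25 (F : fieldType) :
  (forall n : nat, (6 < n)%N ->
     let Delta := total_cut_complex (@cycle_square n) 2 in
     ~ linear_resolution (sr_ideal F Delta) /\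
     ~ cohen_macaulay (sr_ring F Delta)) /\
  (let Delta := total_cut_complex (@cycle_square 6) 2 in
   let beta := graded_betti (sr_ideal F Delta) in
   linear_resolution (sr_ideal F Delta) /\
   [/\ beta 0 (Posz 0) = 1, beta 4 (Posz 6) = 1, beta 1 (Posz 3) = 8,
       beta 2 (Posz 4) = 12 & beta 3 (Posz 5) = 6]%N /\
   (forall (i : nat) (j : int),
      (i, j) \notin [:: (0, Posz 0); (4, Posz 6); (1, Posz 3); (2, Posz 4); (3, Posz 5)]%N ->
      beta i j = 0%N) /\
   ~ cohen_macaulay (sr_ring F Delta)).
Proof.
split; first exact: cycle_square_large.
exact: cycle_square_six.
Qed.
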